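(* Let $(G\to G/P,\mu)$ be the homogeneous model of a parabolic geometry of type $(G,P)$, with $G/P$ connected. Then all symmetries of the homogeneous model centered at any point are parametrized by the elements $g_0\exp Z\in P$, where $Z\in\mathfrak p_+$ is arbitrary and $g_0\in G_0$ is such that $\mathrm{Ad}_{g_0}|_{\mathfrak g_{-1}}=-\mathrm{id}|_{\mathfrak g_{-1}}$. That is: the symmetries centered at the origin $o=eP$ are exactly the maps $\ell_g:G/P\to G/P$, $\ell_g(aP)=gaP$, with $g=g_0\exp Z$ of this form, and the symmetries centered at $hP$ ($h\in G$) are exactly the maps $\ell_{hgh^{-1}}$ with $g$ of this form. In particular, if there is one symmetry at a point, then there are infinitely many symmetries at that point.
   Context: A Cartan geometry of type $(G,P)$ on a manifold $M$ is a principal $P$-bundle $\mathcal G\to M$ with a one-form $\omega\in\Omega^1(\mathcal G,\mathfrak g)$ (the Cartan connection) that is $P$-equivariant, reproduces the generators of fundamental vector fields, and restricts to a linear isomorphism $T_u\mathcal G\cong\mathfrak g$ for each $u\in\mathcal G$. A parabolic geometry is a Cartan geometry of type $(G,P)$ with $G$ a semisimple Lie group and $P$ a parabolic subgroup. The Lie algebra of $G$ carries a grading $\mathfrak g=\mathfrak g_{-k}\oplus\dots\oplus\mathfrak g_k$ (with $k\ge 1$) such that the Lie algebra of $P$ is $\mathfrak p=\mathfrak g_0\oplus\dots\oplus\mathfrak g_k$; put $\mathfrak p_+=\mathfrak g_1\oplus\dots\oplus\mathfrak g_k$, $P_+=\exp\mathfrak p_+$, and let $G_0\subset P$ be the subgroup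 (with Lie algebra $\mathfrak g_0$) of all elements whose adjoint action preserves the grading; then $P=G_0\rtimes P_+$. As usual for parabolic geometries, the kernel of $(G,P)$ (the maximal normal subgroup of $G$ contained in $P$) is discrete. The homogeneous model is the $P$-bundle $G\to G/P$ with the left Maurer--Cartan form $\mu\in\Omega^1(G,\mathfrak g)$ as Cartan connection. An automorphism of a Cartan geometry $(\mathcal G\to M,\omega)$ is a principal bundle automorphism $\varphi:\mathcal G\to\mathcal G$ with $\varphi^*\omega=\omega$. The Cartan connection gives $TM\cong\mathcal G\times_P(\mathfrak g/\mathfrak p)$, and $T^{-1}M\subset TM$ denotes the subbundle $\mathcal G\times_P(\mathfrak g^{-1}/\mathfrak p)$, where $\mathfrak g^{-1}=\mathfrak g_{-1}\oplus\mathfrak p$. A symmetry of the parabolic geometry centered at $x\in M$ is a diffeomorphism $s_x$ of $M$ such that (i) $s_x(x)=x$; (ii) $T_xs_x|_{T_x^{-1}M}=-\mathrm{id}_{T^{-1}_xM}$; (iii) $s_x$ is covered by an automorphism of the parabolic geometry. *)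

(* Defs.v *)
From HB Require Import structures.
From mathcomp Require Import all_boot all_order all_algebra generic_quotient.
From mathcomp Require Import all_classical all_reals all_analysis.

Set Implicit Arguments.
Unset Strict Implicit.
Unset Printing Implicit Defensive.

Import Order.TTheory GRing.Theory Num.Theory.
Import numFieldNormedType.Exports.

Local Open Scope classical_set_scope.
Local Open Scope ring_scope.

Section Smooth.
Context {R : realType} {V W : normedModType R}.

(* Meaningful for open [U] only: continuity and differentiability are those of
   the ambient space.  For open [U], [f] is of class C^(k+1) iff it is
   differentiable and all its directional derivatives are of class C^k. *)
Fixpoint Ck_on (k : nat) (U : set V) (f : V -> W) : Prop :=
  match k with
  | 0%N => forall x, U x -> {for x, continuous f}
  | k'.+1 => (forall x, U x -> differentiable f x) /\
             (forall v, Ck_on k' U (fun x => 'D_v f x))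
  end.

Definition smooth_on (U : set V) (f : V -> W) : Prop :=
  forall k, Ck_on k U f.

End Smooth.

(* The values of [cmap] off [cdom] and of [cinv] off [cmap @` cdom] are
   irrelevant. *)
Record chart (R : realType) (T : topologicalType) (n : nat) := Chart {
  cdom : set T ;
  cmap :> T -> 'rV[R]_n ;
  cinv : 'rV[R]_n -> T ;
  cdom_open : open cdom ;
  cimg_open : open (cmap @` cdom) ;
  cmapK : forall x, cdom x -> cinv (cmap x) = x ;
  cmap_cont : forall x, cdom x -> {for x, continuous cmap} ;
  cinv_cont : forall y, (cmap @` cdom) y -> {for y, continuous cinv} }.

(* A smooth n-manifold structure on [T]: a smooth atlas in which a preferred
   chart around each point has been singled out.  The preferred charts alone
   form an atlas of the smooth structure, and [chart_at x] identifies the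
   tangent space at [x] with R^n, so that tangent vectors at any point are
   elements of ['rV[R]_n]. *)
Record manifold (R : realType) (T : topologicalType) (n : nat) := Manifold {
  chart_at : T -> chart R T n ;
  chart_at_mem : forall x, cdom (chart_at x) x ;
  chart_at_compat : forall x y,
    smooth_on (chart_at x @` (cdom (chart_at x) `&` cdom (chart_at y)))
              (chart_at y \o cinv (chart_at x)) ;
  manifold_hausdorff : hausdorff_space T ;
  manifold_second_countable : @second_countable T }.

Section SmoothMaps.
Context {R : realType} {S T : topologicalType} {n m : nat}.
Variables (A : manifold R S n) (B : manifold R T m).

Definition read_in_charts (f : S -> T) (x : S) : 'rV[R]_n -> 'rV[R]_m :=
  chart_at B (f x) \o f \o cinv (chart_at A x).

Definition smooth (f : S -> T) : Prop :=
  continuous f /\ forall x,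
    smooth_on (chart_at A x @` (cdom (chart_at A x) `&`
                                f @^-1` cdom (chart_at B (f x))))
              (read_in_charts f x).

Definition tangent_map (f : S -> T) (x : S) : 'rV[R]_n -> 'rV[R]_m :=
  'd (read_in_charts f x) (chart_at A x x).

Definition submersion (f : S -> T) : Prop :=
  smooth f /\ forall x w, exists v, tangent_map f x v = w.

Definition smooth_curve (c : R -> S) : Prop :=
  continuous c /\ forall t : R,
    smooth_on (c @^-1` cdom (chart_at A (c t))) (chart_at A (c t) \o c).

Definition velocity (c : R -> S) (t : R) : 'rV[R]_n :=
  'D_1 (chart_at A (c t) \o c) t.

End SmoothMaps.

Definition diffeomorphism (R : realType) (S T : topologicalType) (n m : nat)
    (A : manifold R S n) (B : manifold R T m) (f : S -> T) : Prop :=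
  smooth A B f /\
  exists g : T -> S, [/\ smooth B A g, cancel f g & cancel g f].

(* Groups whose underlying set carries a topology; the compatibility of the two
   is part of [lie_group]. *)
#[short(type="groupWithTopologyType")]
HB.structure Definition GroupWithTopology := {G of Group G & Topological G}.

Section LieGroups.
Context {R : realType} {G : groupWithTopologyType} {n : nat}.
Variable A : manifold R G n.

(* Smoothness of the multiplication is that of a map from the product manifold:
   the products of the charts at [a] and at [b] are charts around [(a, b)]. *)
Definition lie_group : Prop :=
  [/\ continuous (fun z : G * G => (z.1 * z.2)%g),
      forall a b : G,
        smooth_on
          [set z : 'rV[R]_n * 'rV[R]_n |
            [/\ (chart_at A a @` cdom (chart_at A a)) z.1,
                (chart_at A b @` cdom (chart_at A b)) z.2 &
                cdom (chart_at A (a * b)%g)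
                  (cinv (chart_at A a) z.1 * cinv (chart_at A b) z.2)%g]]
          (fun z => chart_at A (a * b)%g
                  (cinv (chart_at A a) z.1 * cinv (chart_at A b) z.2)%g) &
      smooth A A (fun a : G => a^-1%g)].

(* The Lie algebra is T_1 G = 'rV[R]_n. *)
Definition Ad (g : G) : 'rV[R]_n -> 'rV[R]_n :=
  tangent_map A A (fun a => (g * a * g^-1)%g) 1%g.

(* [X, Y] = ad X Y, where ad is the differential of Ad at 1. *)
Definition lie_bracket (X Y : 'rV[R]_n) : 'rV[R]_n :=
  'd (fun v => Ad (cinv (chart_at A 1%g) v) Y) (chart_at A 1%g 1%g) X.

Definition killing_form (X Y : 'rV[R]_n) : R :=
  \tr (lin1_mx (lie_bracket X) *m lin1_mx (lie_bracket Y)).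

(* Semisimplicity as in Helgason, "Differential Geometry, Lie Groups, and
   Symmetric Spaces": the Killing form is nondegenerate. *)
Definition semisimple : Prop :=
  forall X, (forall Y, killing_form X Y = 0) -> X = 0.

(* This determines the map [e]: t |-> e (t X) is the one-parameter subgroup
   with initial velocity X. *)
Definition exponential_map (e : 'rV[R]_n -> G) : Prop :=
  forall X,
    [/\ smooth_curve A (fun t : R => e (t *: X)),
        forall s t : R, e ((s + t) *: X) = (e (s *: X) * e (t *: X))%g &
        velocity A (fun t : R => e (t *: X)) 0 = X].

Definition maurer_cartan (a : G) (v : 'rV[R]_n) : 'rV[R]_n :=
  tangent_map A A (fun b => (a^-1 * b)%g) a v.

End LieGroups.

Section Grading.
Context {R : realType} {n : nat}.
Implicit Types (br : 'rV[R]_n -> 'rV[R]_n -> 'rV[R]_n).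
Implicit Types (gr : int -> {vspace 'rV[R]_n}).

Definition lie_grading br (k : nat) gr : Prop :=
  [/\ [/\ (0 < k)%N, gr k%:Z != 0%VS & gr (- k%:Z) != 0%VS],
      forall i : int, k%:Z < `|i| -> gr i = 0%VS,
      directv (\sum_(j < (2 * k).+1) gr (j%:Z - k%:Z)),
      (\sum_(j < (2 * k).+1) gr (j%:Z - k%:Z))%VS = fullv &
      forall i j X Y, X \in gr i -> Y \in gr j -> br X Y \in gr (i + j)].

(* g^i = g_i + ... + g_k; thus p = g^0 and p_+ = g^1. *)
Definition filtration (k : nat) gr (i : int) : {vspace 'rV[R]_n} :=
  (\sum_(j < (2 * k).+1 | (i <= j%:Z - k%:Z)%R) gr (j%:Z - k%:Z))%VS.

End Grading.

Section Subgroups.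
Context {G : groupWithTopologyType}.
Implicit Types P K : set G.

Definition subgroup P : Prop :=
  [/\ P 1%g, forall a b, P a -> P b -> P (a * b)%g &
      forall a, P a -> P a^-1%g].

Definition normal_subgroup K : Prop :=
  subgroup K /\ forall a b, K b -> K (a * b * a^-1)%g.

(* The largest normal subgroup of G contained in P. *)
Definition pair_kernel P : set G :=
  [set a | exists K, [/\ normal_subgroup K, K `<=` P & K a]].

Definition discrete_subgroup K : Prop :=
  forall a, K a -> \forall b \near a, K b -> b = a.

Definition lcoset P (a : G) : set G := [set (a * b)%g | b in P].

Definition lcoset_rel P : rel G := fun a b => `[< lcoset P a = lcoset P b >].

Lemma lcoset_rel_equiv P : equiv_class_of (lcoset_rel P).
Proof.
split=> [a|a b|b a c]; rewrite /lcoset_rel.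
- exact/asboolP.
- by apply/asboolP/asboolP => ->.
- by move=> /asboolP -> /asboolP ->; exact/asboolP.
Qed.

Canonical lcoset_equiv P : equiv_rel G := EquivRelPack (lcoset_rel_equiv P).

(* G/P with the quotient topology. *)
Definition coset_space P : topologicalType :=
  quotient_topology {eq_quot (lcoset_equiv P)}%qT.

Definition coset_proj P (a : G) : coset_space P :=
  (\pi_{eq_quot (lcoset_equiv P)}%qT a)%qT.

Definition left_translation P (g : G) (x : coset_space P) : coset_space P :=
  coset_proj P (g * repr (x : {eq_quot (lcoset_equiv P)}%qT))%g.

End Subgroups.

Arguments left_translation {G} P g x.

Section Parabolic.
Context {R : realType} {G : groupWithTopologyType} {n : nat}.
Variables (A : manifold R G n) (expG : 'rV[R]_n -> G).
Variables (P : set G) (k : nat) (gr : int -> {vspace 'rV[R]_n}).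

(* The parabolic subgroups corresponding to the grading are the closed
   subgroups with Lie algebra g^0 which preserve the filtration (Cap-Slovak,
   "Parabolic Geometries I"): they lie between the intersection of the
   normalizers of the g^i and its identity component.  The Lie algebra of a
   closed subgroup P consists of the X with exp (t X) in P for all t. *)
Definition parabolic_subgroup : Prop :=
  [/\ subgroup P, closed P,
      forall X, (forall t : R, P (expG (t *: X))) <-> X \in filtration k gr 0 &
      forall g, P g -> forall i X,
        X \in filtration k gr i -> Ad A g X \in filtration k gr i].

Definition levi_subgroup : set G :=
  [set g | P g /\ forall i X, X \in gr i -> Ad A g X \in gr i].

End Parabolic.

(* The data underlying a Cartan geometry of type (G, P): the total space and
   the base, the projection, the right action of P (only the values [cg_act u h]
   with h in P matter), and the Cartan connection with values in g. *)
Record cartan_data (R : realType) (G : groupWithTopologyType) (P : set G)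
    (n m : nat) := CartanData {
  cg_total : topologicalType ;
  cg_base : topologicalType ;
  cg_total_mfd : manifold R cg_total n ;
  cg_base_mfd : manifold R cg_base m ;
  cg_proj : cg_total -> cg_base ;
  cg_act : cg_total -> G -> cg_total ;
  cg_omega : cg_total -> 'rV[R]_n -> 'rV[R]_n }.

Arguments cg_proj {R G P n m} c _.

Section Symmetries.
Context {R : realType} {G : groupWithTopologyType} {P : set G} {n m : nat}.
Variable C : cartan_data R P n m.

Definition cartan_automorphism (phi : cg_total C -> cg_total C) : Prop :=
  [/\ diffeomorphism (cg_total_mfd C) (cg_total_mfd C) phi,
      forall u h, P h -> phi (cg_act u h) = cg_act (phi u) h &
      forall u v,
        cg_omega (phi u) (tangent_map (cg_total_mfd C) (cg_total_mfd C) phi u v)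
        = cg_omega u v].

(* The identification of the associated bundle of g/p with TM sends the class
   of (u, X + p) to T_u proj (omega_u^-1 X). *)
Definition Tminus1 k (gr : int -> {vspace 'rV[R]_n}) (x : cg_base C) :
    set 'rV[R]_m :=
  [set w | exists u v,
    [/\ cg_proj C u = x, cg_omega u v \in filtration k gr (-1) &
        w = tangent_map (cg_total_mfd C) (cg_base_mfd C) (cg_proj C) u v]].

Definition symmetry k (gr : int -> {vspace 'rV[R]_n}) (x : cg_base C)
    (s : cg_base C -> cg_base C) : Prop :=
  [/\ diffeomorphism (cg_base_mfd C) (cg_base_mfd C) s,
      s x = x,
      forall w, Tminus1 k gr x w ->
        tangent_map (cg_base_mfd C) (cg_base_mfd C) s x w = - w &
      exists phi, cartan_automorphism phi /\
        forall u, cg_proj C (phi u) = s (cg_proj C u)].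

End Symmetries.

Arguments symmetry {R G P n m} C k gr x s.

Definition homogeneous_model (R : realType) (G : groupWithTopologyType)
    (n m : nat) (A : manifold R G n) (P : set G)
    (B : manifold R (coset_space P) m) : cartan_data R P n m :=
  {| cg_total := G ;
     cg_base := coset_space P ;
     cg_total_mfd := A ;
     cg_base_mfd := B ;
     cg_proj := coset_proj P ;
     cg_act := fun a h => (a * h)%g ;
     cg_omega := maurer_cartan A |}.

(* The elements g0 exp Z with g0 in G_0, Ad g0 = -id on g_{-1} and Z in p_+. *)
Definition symmetry_elements (R : realType) (G : groupWithTopologyType)
    (n : nat) (A : manifold R G n) (expG : 'rV[R]_n -> G) (P : set G)
    (k : nat) (gr : int -> {vspace 'rV[R]_n}) : set G :=
  [set g | exists g0 Z,
    [/\ levi_subgroup A P gr g0,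
        forall X, X \in gr (-1) -> Ad A g0 X = - X,
        Z \in filtration k gr 1 &
        g = (g0 * expG Z)%g]].

(* Main.v *)
(* An automorphism [phi] of the homogeneous model preserves the Maurer-Cartan form, hence
   [a |-> phi a * a^-1] has zero derivative; it descends to the connected space [G/P], so
   [phi] is a left translation.  Conversely, left translations of [G/P] are smooth because
   smoothness descends along the submersion [G -> G/P].  The translation by [h g h^-1] with
   [g] in [P] is a symmetry at [hP] iff [Ad g + id] maps [g^(-1)] into [p], since the kernel
   of the differential of [a |-> h a P] at [1] is [p].  Writing [g = g_0 exp Z], where [exp Z]
   acts trivially on [g^(-1)/p], this says that [Ad g_0 = - id] on [g_(-1)].  The decomposition
   [P = G_0 exp p_+] comes from the grading element [E], which exists because derivations of a
   semisimple algebra are inner: [Ad g^-1 E = Ad (exp Z) E] for some [Z] in [p_+], and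
   [g exp Z] then fixes [E].  Finally, [exp (t Z)] for small [t] gives infinitely many
   symmetries because the kernel of [(G, P)] is discrete. *)
Require Import Defs.
From HB Require Import structures.
From mathcomp Require Import all_boot all_order all_algebra.
From mathcomp Require Import all_classical all_reals all_analysis.
From mathcomp Require Import ring lra zify.

Set Implicit Arguments.
Unset Strict Implicit.
Unset Printing Implicit Defensive.

Import Order.TTheory GRing.Theory Num.Theory.
Import numFieldNormedType.Exports.

Local Open Scope classical_set_scope.
Local Open Scope ring_scope.

(** * Differentials *)

Section Differentiability.
Context {R : realType}.

(** No theory of flows or of differential equations enters: each such step is reduced to the fact
    that a map with vanishing differential is locally constant. Thus [Ad (exp Z)] is computed only
    on vectors on which [ad Z] is nilpotent, and a vanishing velocity of the curve [h exp (t X) P]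
    at time 0 is carried along the curve by translations. The smooth structure on [G/P] is known
    only to make the projection a submersion, so smoothness has to be descended; this takes a local
    section, built by the contraction principle, and an induction on the order of differentiability.
    As [lie_bracket] is the derivative of [Ad], the Jacobi identity arises in Leibniz form, by
    differentiating the invariance of the bracket under [Ad]. Antisymmetry does not come from second
    derivatives but from the Leibniz rule and the nondegeneracy of the Killing form. The element [Z]
    attached to [Ad g^-1 E] is found degree by degree; this can start because [Ad g^-1 E - E] has no
    component of degree 0, both elements acting by [i] on the quotient of [g^i] by [g^(i+1)]. *)

Lemma is_diff_eps (V W : normedModType R) (f : V -> W) x (L : {linear V -> W}) :
    continuous L ->
    (forall e : R, 0 < e ->
      \forall y \near x, `|f y - f x - L (y - x)| <= e * `|y - x|) ->
  is_diff x f L.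
Proof.
move=> Lc fL.
have fE : f \o shift x = cst (f x) + L +o_ 0 id.
  apply/eqaddoP => e e0; have := fL e e0.
  rewrite (near_shift 0) subr0 /= => H; near=> h.
  rewrite !fctE /=.
  rewrite opprD addrA; have -> : h = h + x - x by rewrite addrK.
  by rewrite [_ - x + x]subrK; near: h; exact: H.
have dE := diff_unique Lc fE.
by apply: DiffDef => //; apply/diff_locallyP; rewrite dE.
Unshelve. all: by end_near. Qed.

Lemma diff_eps (V W : normedModType R) (f : V -> W) x : differentiable f x ->
  forall e : R, 0 < e ->
    \forall y \near x, `|f y - f x - 'd f x (y - x)| <= e * `|y - x|.
Proof.
move=> /diff_locallyP[_ fE] e e0.
rewrite (near_shift 0) subr0.
move/eqaddoP : fE => /(_ e e0); apply: filterS => h.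
by rewrite !fctE /= opprD addrA addrK.
Qed.

Lemma near_eq_is_diff (V W : normedModType R) (f g : V -> W) x :
  (\near x, f x = g x) -> differentiable f x -> is_diff x g ('d f x).
Proof.
move=> fg df; apply: is_diff_eps; first exact: diff_continuous.
move=> e e0; have fgx := nbhs_singleton fg.
rewrite -fgx; near=> y.
have <- : f y = g y by near: y; exact: fg.
near: y; exact: diff_eps.
Unshelve. all: by end_near. Qed.

Lemma near_eq_differentiable (V W : normedModType R) (f g : V -> W) x :
  (\near x, f x = g x) -> differentiable f x -> differentiable g x.
Proof. by move=> fg df; case: (near_eq_is_diff fg df). Qed.

Lemma near_eq_diff (V W : normedModType R) (f g : V -> W) x :
  (\near x, f x = g x) -> differentiable f x -> 'd g x = 'd f x :> (V -> W).
Proof. by move=> fg df; case: (near_eq_is_diff fg df). Qed.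

Lemma linear_rV_continuous (n : nat) (W : normedModType R)
  (L : {linear 'rV[R]_n -> W}) : continuous L.
Proof.
have -> : L = (fun v : 'rV[R]_n => \sum_(i < n) v 0 i *: L (delta_mx 0 i)) :> (_ -> _).
  apply/funext => v; rewrite {1}(row_sum_delta v) linear_sum.
  by apply: eq_bigr => i _; rewrite linearZ.
apply: continuous_big => [|i _ v]; first exact: add_continuous.
apply/differentiable_continuous/differentiableZl.
exact: differentiable_coord.
Qed.

Lemma linear_rV_differentiable (n : nat) (W : normedModType R)
  (L : {linear 'rV[R]_n -> W}) x : differentiable L x.
Proof. exact/linear_differentiable/linear_rV_continuous. Qed.

Lemma differentiable_rV (V : normedModType R) (n : nat) (f : V -> 'rV[R]_n) x :
  (forall j, differentiable (fun y => f y 0 j) x) -> differentiable f x.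
Proof.
move=> df.
have -> : f = \sum_(j < n) (fun y => f y 0 j *: (delta_mx 0 j : 'rV[R]_n)).
  by apply/funext => y; rewrite fct_sumE; exact: row_sum_delta.
by apply: differentiable_sum => j; exact: differentiableZl.
Qed.

Lemma diff_rV (V : normedModType R) (n : nat) (f : V -> 'rV[R]_n) x v j :
  differentiable f x -> 'd f x v 0 j = 'd (fun y => f y 0 j) x v.
Proof.
move=> df; have dj : differentiable (fun N : 'rV[R]_n => N 0 j : R) (f x).
  exact: differentiable_coord.
have cl : linear (fun N : 'rV[R]_n => N 0 j : R) by move=> a u w; rewrite !mxE.
pose c : {linear 'rV[R]_n -> R} := HB.pack (fun N : 'rV[R]_n => N 0 j : R)
  (GRing.isLinear.Build _ _ _ _ _ cl).
have := diff_comp df dj; rewrite /comp => /(congr1 (fun h => h v)) ->.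
rewrite -[fun N : 'rV[R]_n => N 0 j : R]/(c : _ -> _) diff_lin //.
exact: coord_continuous.
Qed.

End Differentiability.

(* The unifier diverges when it compares two instances of [diff], hence the
   lock. *)
HB.lock Definition differential (R : realType) (V W : normedModType R) (f : V -> W)
  (x : V) : V -> W := 'd f x.

Section LockedDifferential.
Context {R : realType}.
Implicit Types V W : normedModType R.

Lemma differential_is_linear V W (f : V -> W) x : linear (differential f x).
Proof. by move=> a u v; rewrite differential.unlock linearP. Qed.

HB.instance Definition _ V W (f : V -> W) x :=
  GRing.isLinear.Build R V W _ (differential f x) (differential_is_linear f x).

Lemma differential_is_diff V W (f L : V -> W) x v :
  is_diff x f L -> differential f x v = L v.
Proof. by case=> _ dE; rewrite differential.unlock dE. Qed.

Lemma derive_differential V W (f : V -> W) x v :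
  differentiable f x -> 'D_v f x = differential f x v.
Proof. by move=> df; rewrite differential.unlock deriveE. Qed.

Lemma differential_comp V W V' (f : V -> W) (g : W -> V') x v :
  differentiable f x -> differentiable g (f x) ->
  differential (g \o f) x v = differential g (f x) (differential f x v).
Proof. by move=> df dg; rewrite differential.unlock (diff_comp df dg). Qed.

Lemma near_eq_differential V W (f g : V -> W) x v :
  (\near x, f x = g x) -> differentiable f x ->
  differential f x v = differential g x v.
Proof. by move=> fg df; rewrite differential.unlock -(near_eq_diff fg df). Qed.

Lemma differential_eps V W (f : V -> W) x : differentiable f x ->
  forall e : R, 0 < e ->
    \forall y \near x, `|f y - f x - differential f x (y - x)| <= e * `|y - x|.
Proof. by move=> df; rewrite differential.unlock; exact: diff_eps. Qed.

Lemma differentialD V W (f g : V -> W) x v :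
  differentiable f x -> differentiable g x ->
  differential (fun y => f y + g y) x v = differential f x v + differential g x v.
Proof.
move=> df dg; rewrite differential.unlock.
exact: (congr1 (fun h => h v) (diffD df dg)).
Qed.

Lemma differentialB V W (f g : V -> W) x v :
  differentiable f x -> differentiable g x ->
  differential (fun y => f y - g y) x v = differential f x v - differential g x v.
Proof.
move=> df dg; rewrite differential.unlock.
exact: (congr1 (fun h => h v) (diffB df dg)).
Qed.

Lemma differential_id V (x : V) v : differential id x v = v.
Proof. by apply: differential_is_diff; exact: is_diff_id. Qed.

Lemma differential_cst V W (c : W) (x : V) v : differential (fun=> c) x v = 0.
Proof. by rewrite (differential_is_diff v (is_diff_cst c x)). Qed.

Lemma differential_linear V W (L : {linear V -> W}) x v : continuous L ->
  differential L x v = L v.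
Proof. by move=> cL; rewrite differential.unlock diff_lin. Qed.

Lemma differential_rV V n (f : V -> 'rV[R]_n) x v j : differentiable f x ->
  differential f x v 0 j = differential (fun y => f y 0 j) x v.
Proof. by rewrite differential.unlock; exact: diff_rV. Qed.

Lemma differential_pair V W W' (f : V -> W) (g : V -> W') x v :
  differentiable f x -> differentiable g x ->
  differential (fun y => (f y, g y)) x v = (differential f x v, differential g x v).
Proof. by move=> df dg; rewrite differential.unlock diff_pair. Qed.

End LockedDifferential.

(** * Calculus of [Ck_on] *)

Section CkCalculus.
Context {R : realType}.

Lemma near_eq_continuous (V W : topologicalType) (f g : V -> W) x :
  (\near x, f x = g x) -> {for x, continuous f} -> {for x, continuous g}.
Proof.
move=> fg cf; change (g y @[y --> x] --> g x); rewrite -(nbhs_singleton fg).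
apply: cvg_trans cf; apply: near_eq_cvg.
by apply: filterS fg => y ->.
Qed.

Section General.
Context {V W : normedModType R}.
Implicit Types (U O : set V) (f g : V -> W).

(** Every clause of [Ck_on] is a condition at one point with respect to the ambient space, so the
    property can be checked point by point. *)
Lemma Ck_on_local k U f :
  (forall x, U x -> exists2 O, O x & Ck_on k O f) -> Ck_on k U f.
Proof.
elim: k f => [|k IH] f H /=; first by move=> x Ux; have [Q Qx] := H x Ux; exact.
split=> [x /H[Q Qx [df _]]|v]; first exact: df.
by apply: IH => x /H[Q Qx [_ dv]]; exists Q => //; exact: dv.
Qed.

Lemma Ck_on_sub k U O f : O `<=` U -> Ck_on k U f -> Ck_on k O f.
Proof. by move=> OU fU; apply: Ck_on_local => x /OU Ux; exists U. Qed.

Lemma Ck_onS k U f : Ck_on k.+1 U f <->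
  (forall x, U x -> differentiable f x) /\ forall v, Ck_on k U ('D_v f).
Proof. by []. Qed.

Lemma Ck_onW k U f : Ck_on k.+1 U f -> Ck_on k U f.
Proof.
elim: k f => [|k IH] f [df dvf].
  by move=> x /df; exact: differentiable_continuous.
by split=> // v; exact: IH.
Qed.

Lemma eq_Ck_on k U f g : open U -> (forall x, U x -> f x = g x) ->
  Ck_on k U f -> Ck_on k U g.
Proof.
move=> oU; have near_fg f' g' x : (forall x, U x -> f' x = g' x) -> U x ->
    \near x, (f' x = g' x :> W).
  by move=> fg Ux; apply: filterS fg _; apply: open_nbhs_nbhs.
elim: k f g => [|k IH] f g fg /=.
  by move=> cf x Ux; apply: near_eq_continuous (cf x Ux); exact: near_fg.
move=> [df dvf]; split=> [x Ux|v].
  by apply: near_eq_differentiable (df x Ux); exact: near_fg.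
apply: IH (dvf v) => x Ux; apply: near_eq_derive.
exact: near_fg.
Qed.

Lemma Ck_on_cst k U (c : W) : Ck_on k U (fun=> c).
Proof.
elim: k c => [|k IH] c /=; first by move=> x _; exact: cst_continuous.
split=> [x _|v]; first exact: differentiable_cst.
rewrite (_ : 'D_v _ = fun=> 0) //.
by apply/funext => x; exact: derive_cst.
Qed.

Lemma Ck_on_linear k U (L : {linear V -> W}) : continuous L -> Ck_on k U L.
Proof.
case: k => [|k] cL /=; first by move=> x _; exact: cL.
split=> [x _|v]; first exact: linear_differentiable.
rewrite (_ : (fun x => _) = fun=> L v); first exact: Ck_on_cst.
apply/funext => x; rewrite deriveE; last exact: linear_differentiable.
by rewrite diff_lin.
Qed.

Lemma Ck_onD k U f g : open U ->
  Ck_on k U f -> Ck_on k U g -> Ck_on k U (fun x => f x + g x).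
Proof.
move=> oU; elim: k f g => [|k IH] f g /=.
  by move=> cf cg x Ux; apply: cvgD; [exact: cf|exact: cg].
move=> [df dvf] [dg dvg]; split=> [x Ux|v].
  by apply: differentiableD; [exact: df|exact: dg].
apply: eq_Ck_on (IH _ _ (dvf v) (dvg v)) => // x Ux.
by rewrite deriveD //; apply: diff_derivable; [exact: df|exact: dg].
Qed.

Lemma Ck_on_sum k U (I : Type) (r : seq I) (F : I -> V -> W) : open U ->
  (forall i, Ck_on k U (F i)) -> Ck_on k U (fun x => \sum_(i <- r) F i x).
Proof.
move=> oU cF; elim: r => [|i r IH].
  rewrite (_ : (fun x => _) = fun=> 0); first exact: Ck_on_cst.
  by apply/funext => x; rewrite big_nil.
rewrite (_ : (fun x => _) = fun x => F i x + \sum_(j <- r) F j x).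
  exact: Ck_onD.
by apply/funext => x; rewrite big_cons.
Qed.

End General.

Lemma Ck_on_linear_comp (V W W' : normedModType R) k (U : set V) (f : V -> W)
    (L : {linear W -> W'}) : open U -> continuous L ->
  Ck_on k U f -> Ck_on k U (fun x => L (f x)).
Proof.
move=> oU cL; elim: k f => [|k IH] f /=.
  by move=> cf x Ux; apply: continuous_comp; [exact: cf|exact: cL].
move=> [df dvf]; split=> [x Ux|v].
  by apply: differentiable_comp; [exact: df|exact: linear_differentiable].
apply: eq_Ck_on (IH _ (dvf v)) => // x Ux.
have dL y : differentiable L y by exact: linear_differentiable.
rewrite !deriveE; [|by apply: differentiable_comp; [exact: df|]|exact: df].
by rewrite (diff_comp (df x Ux) (dL _)) /= diff_lin.
Qed.

(** The differential of [a] is the same map [l] at every point, so the derivative of [f \o a] along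
    [v] is the derivative of [f] along [l v], composed with [a]. The induction runs on [f] alone and
    works for arbitrary normed spaces. *)
Lemma Ck_on_affine_comp (V' V W : normedModType R) k (O : set V') (U : set V)
    (f : V -> W) (a l : V' -> V) : open O -> (forall x, O x -> U (a x)) ->
  (forall x, is_diff x a l) -> Ck_on k U f -> Ck_on k O (f \o a).
Proof.
move=> oO aO da; elim: k f => [|k IH] f /=.
  move=> cf x Ox; apply: continuous_comp; last exact/cf/aO.
  by apply: differentiable_continuous; case: (da x).
have dax x : differentiable a x by case: (da x).
move=> [df dvf]; split=> [x Ox|v].
  by apply: differentiable_comp; [|exact/df/aO].
apply: eq_Ck_on (IH _ (dvf (l v))) => // x Ox.
have dfx := df _ (aO _ Ox).
rewrite /= !deriveE //; last exact: differentiable_comp.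
by rewrite (diff_comp (dax x) dfx) /=; case: (da x) => _ ->.
Qed.

Lemma Ck_onM (V : normedModType R) k (U : set V) (f g : V -> R) : open U ->
  Ck_on k U f -> Ck_on k U g -> Ck_on k U (fun x => f x * g x).
Proof.
move=> oU; elim: k f g => [|k IH] f g.
  by move=> cf cg x Ux; apply: cvgM; [exact: cf|exact: cg].
move=> sf sg; have /Ck_onS[df dvf] := sf; have /Ck_onS[dg dvg] := sg.
split=> [x Ux|v].
  by apply: differentiableM; [exact: df|exact: dg].
have cf := Ck_onW sf; have cg := Ck_onW sg.
apply: eq_Ck_on (Ck_onD oU (IH _ _ cf (dvg v)) (IH _ _ cg (dvf v))) => // x Ux.
by rewrite [RHS]deriveM //; apply: diff_derivable; [exact: df|exact: dg].
Qed.

Lemma Ck_on_prod (V : normedModType R) k (U : set V) (I : Type) (r : seq I)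
    (F : I -> V -> R) : open U ->
  (forall i, Ck_on k U (F i)) -> Ck_on k U (fun x => \prod_(i <- r) F i x).
Proof.
move=> oU cF; elim: r => [|i r IH].
  rewrite (_ : (fun x => _) = fun=> 1); first exact: Ck_on_cst.
  by apply/funext => x; rewrite big_nil.
rewrite (_ : (fun x => _) = fun x => F i x * \prod_(j <- r) F j x).
  exact: Ck_onM.
by apply/funext => x; rewrite big_cons.
Qed.

Lemma Ck_onV (V : normedModType R) k (U : set V) (f : V -> R) : open U ->
  (forall x, U x -> f x != 0) -> Ck_on k U f -> Ck_on k U (fun x => (f x)^-1).
Proof.
move=> oU f0; elim: k f f0 => [|k IH] f f0.
  by move=> cf x Ux; apply: cvgV; [exact: f0|exact: cf].
move=> sf; have /Ck_onS[df dvf] := sf; split=> [x Ux|v].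
  by apply: differentiableV; [exact: df|exact: f0].
have Vf := IH f f0 (Ck_onW sf).
have dVf : Ck_on k U (fun x => -1 * ((f x)^-1 * (f x)^-1 * 'D_v f x)).
  apply: Ck_onM => //; first exact: Ck_on_cst.
  by apply: Ck_onM => //; exact: Ck_onM.
apply: eq_Ck_on dVf => // x Ux.
rewrite [RHS]deriveV ?f0 //; last exact/diff_derivable/df.
by rewrite /GRing.scale /= expr2 invfM mulN1r mulNr.
Qed.

Definition coord_rV n (j : 'I_n) (u : 'rV[R]_n) : R := u 0 j.

Lemma coord_rV_is_linear n (j : 'I_n) : linear (@coord_rV n j).
Proof. by move=> a u v; rewrite /coord_rV !mxE. Qed.

HB.instance Definition _ n (j : 'I_n) :=
  GRing.isLinear.Build R 'rV[R]_n R _ (@coord_rV n j) (@coord_rV_is_linear n j).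

Lemma Ck_on_rV (V : normedModType R) n k (U : set V) (f : V -> 'rV[R]_n) :
  open U -> Ck_on k U f <-> forall j, Ck_on k U (fun x => f x 0 j).
Proof.
move=> oU; split=> [cf j|cf].
  apply: (Ck_on_linear_comp (L := @coord_rV n j)) => //.
  exact: linear_rV_continuous.
have -> : f = fun x => \sum_(j < n) f x 0 j *: (delta_mx 0 j : 'rV[R]_n).
  by apply/funext => x; exact: row_sum_delta.
apply: Ck_on_sum => // j.
have lin_j : linear (fun a : R => a *: (delta_mx 0 j : 'rV[R]_n)).
  by move=> a u v; rewrite scalerDl scalerA.
pose L : {linear R -> 'rV[R]_n} := HB.pack (fun a : R => a *: (delta_mx 0 j : 'rV[R]_n))
  (GRing.isLinear.Build _ _ _ _ _ lin_j).
by apply: (Ck_on_linear_comp (L := L)) => // a; apply: cvgZr_tmp.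
Qed.

(** In coordinates the chain rule is a sum of products of ['D_v g] with the partial derivatives of
    [f] composed with [g]; the latter are of class C^k by induction on the order of [f]. *)
Lemma Ck_on_comp_real (V : normedModType R) n k (O : set V) (U : set 'rV[R]_n)
    (f : 'rV[R]_n -> R) (g : V -> 'rV[R]_n) :
  open O -> (forall x, O x -> U (g x)) ->
  Ck_on k U f -> Ck_on k O g -> Ck_on k O (f \o g).
Proof.
move=> oO gO; elim: k f => [|k IH] f cf cg.
  by move=> x Ox; apply: continuous_comp; [exact: cg|exact/cf/gO].
have /Ck_onS[df dvf] := cf; have /Ck_onS[dg dvg] := cg.
split=> [x Ox|v].
  by apply: differentiable_comp; [exact: dg|exact/df/gO].
apply: (@eq_Ck_on _ _ _ _
    (fun x => \sum_i 'D_v g x 0 i * ('D_(delta_mx 0 i) f \o g) x)) => //.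
  move=> x Ox; have [dgx dfx] := (dg x Ox, df _ (gO x Ox)).
  rewrite [RHS]derive_differential; last exact: differentiable_comp.
  rewrite (differential_comp _ dgx dfx) -(derive_differential _ dgx).
  rewrite [in RHS](row_sum_delta ('D_v g x)) linear_sum; apply: eq_bigr => i _.
  by rewrite /= (derive_differential _ dfx) linearZ.
apply: Ck_on_sum => // i; apply: Ck_onM => //.
  exact: (Ck_on_rV _ _ oO).1.
by apply: (IH ('D_(delta_mx 0 i) f)) => //; exact: Ck_onW.
Qed.

Lemma Ck_on_comp (V : normedModType R) n m k (O : set V) (U : set 'rV[R]_n)
    (f : 'rV[R]_n -> 'rV[R]_m) (g : V -> 'rV[R]_n) :
  open O -> open U -> (forall x, O x -> U (g x)) ->
  Ck_on k U f -> Ck_on k O g -> Ck_on k O (f \o g).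
Proof.
move=> oO oU gO cf cg; apply: (Ck_on_rV _ _ oO).2 => j.
apply: (@Ck_on_comp_real _ _ _ _ U (fun y => f y 0 j) g oO gO) => //.
exact: (Ck_on_rV _ _ oU).1.
Qed.

(** The chain rule above is for functions of a row vector, so the product is identified with
    ['rV[R]_(n1 + n2)] by the linear map [a]. The multiplication of a Lie group in charts is a
    function of such a pair. *)
Lemma Ck_on_comp_pair (V : normedModType R) n1 n2 m k (O : set V)
    (U : set ('rV[R]_n1 * 'rV[R]_n2)) (f : 'rV[R]_n1 * 'rV[R]_n2 -> 'rV[R]_m)
    (g1 : V -> 'rV[R]_n1) (g2 : V -> 'rV[R]_n2) :
  open O -> open U -> (forall x, O x -> U (g1 x, g2 x)) ->
  Ck_on k U f -> Ck_on k O g1 -> Ck_on k O g2 ->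
  Ck_on k O (fun x => f (g1 x, g2 x)).
Proof.
move=> oO oU gO cf cg1 cg2.
pose a (u : 'rV[R]_(n1 + n2)) := (lsubmx u, rsubmx u).
have da u : is_diff u a a.
  have lin (W : normedModType R) (L : {linear 'rV[R]_(n1 + n2) -> W}) : is_diff u L L.
    have cL : continuous L by exact: linear_rV_continuous.
    by apply: DiffDef; [exact: linear_differentiable|rewrite diff_lin].
  by apply: is_diff_pair; exact: lin.
have ca u : {for u, continuous a}.
  by case: (da u) => d _; exact: differentiable_continuous.
have oaU : open (a @^-1` U) by apply: open_comp => // u _; exact: ca.
have caf := @Ck_on_affine_comp _ _ _ k (a @^-1` U) U f a a oaU (fun _ H => H) da cf.
have -> : (fun x => f (g1 x, g2 x)) = (f \o a) \o (fun x => row_mx (g1 x) (g2 x)).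
  by apply/funext => x /=; rewrite /a row_mxKl row_mxKr.
apply: (Ck_on_comp oO oaU) caf _ => [x Ox|].
  by rewrite /a /preimage /= row_mxKl row_mxKr; exact: gO.
apply: (Ck_on_rV _ _ oO).2 => j.
rewrite (_ : (fun x => _) = fun x => match fintype.split j with
    | inl j1 => g1 x 0 j1 | inr j2 => g2 x 0 j2 end); last first.
  by apply/funext => x; rewrite mxE; case: (fintype.split j).
by case: (fintype.split j) => j'; exact: (Ck_on_rV _ _ oO).1.
Qed.

End CkCalculus.

(** * Local sections and descent along submersions *)

(** Row vectors become a complete normed module, as the fixed point theorem in [local_section]
    requires. *)
HB.instance Definition _ (R : realType) (m n : nat) := Complete.on 'M[R]_(m, n).

Section InverseFunction.
Context {R : realType}.

Lemma norm_rV_le n (u : 'rV[R]_n) (c : R) : 0 <= c ->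
  (forall j, `|u 0 j| <= c) -> `|u| <= c.
Proof.
move=> c0 uc; rewrite /Num.Def.normr /= mx_normrE bigmax_le // => -[i j] _ /=.
by rewrite ord1.
Qed.

Lemma coord_le_norm n (u : 'rV[R]_n) j : `|u 0 j| <= `|u|.
Proof.
by rewrite [leRHS]/Num.Def.normr /= mx_normrE; exact: (le_bigmax _ _ (0, j)).
Qed.

Lemma linear_rV_norm n (W : normedModType R) (L : {linear 'rV[R]_n -> W}) (c : R) v :
  (forall i, `|L (delta_mx 0 i)| <= c) -> `|L v| <= n%:R * c * `|v|.
Proof.
move=> Lc; rewrite {1}(row_sum_delta v) linear_sum.
apply: le_trans (ler_norm_sum _ _ _) _.
rewrite -mulrA mulr_natl.
rewrite (_ : _ *+ n = \sum_(i < n) c * `|v|); last by rewrite sumr_const card_ord.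
apply: ler_sum => i _; rewrite linearZ normrZ mulrC.
by apply: ler_pM => //; exact: coord_le_norm.
Qed.

Lemma mean_value (V : normedModType R) (f : V -> R) (a b : V) :
  (forall t : R, 0 <= t <= 1 -> differentiable f (a + t *: (b - a))) ->
  exists2 t : R, 0 <= t <= 1 & f b - f a = differential f (a + t *: (b - a)) (b - a).
Proof.
move=> df; pose l (t : R) : V := a + t *: (b - a).
have dl t : is_diff t l ( *:%R^~ (b - a)).
  by apply: is_diff_eq; rewrite add0r.
have dfl (t : R) : 0 <= t <= 1 -> is_derive t (1 : R) (f \o l) (differential f (l t) (b - a)).
  move=> t01; have dlt : differentiable l t by case: (dl t).
  have dflt : differentiable (f \o l) t.
    by apply: differentiable_comp => //; exact: df.
  apply: DeriveDef; first exact: diff_derivable.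
  rewrite derive_differential // (differential_comp _ dlt (df _ t01)).
  by rewrite (differential_is_diff _ (dl t)) scale1r.
have [||t t01 E] := @MVT_segment R (f \o l) (fun t => differential f (l t) (b - a)) 0 1 ler01.
- by move=> t; rewrite in_itv /= => /andP[t0 t1]; apply: dfl; rewrite !ltW.
- apply: derivable_within_continuous => t; rewrite in_itv /= => t01.
  by case: (dfl t t01).
exists t; first by move: t01; rewrite in_itv.
by move: E; rewrite /= /l scale0r addr0 scale1r [a + _]addrC subrK subr0 mulr1.
Qed.

(** The norm is the maximum of the coordinates, so the mean value theorem may be applied to each
    coordinate with its own intermediate point; the segment stays in the ball by convexity. *)
Lemma ball_lipschitz p n (f : 'rV[R]_p -> 'rV[R]_n) x (r c : R) :
    0 <= c ->
    (forall y, ball x r y -> differentiable f y) ->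
    (forall y v, ball x r y -> `|differential f y v| <= c * `|v|) ->
  forall a b, ball x r a -> ball x r b -> `|f b - f a| <= c * `|b - a|.
Proof.
move=> c0 df dfc a b xa xb.
have seg (t : R) : 0 <= t <= 1 -> ball x r (a + t *: (b - a)).
  move=> /andP[t0 t1]; move: xa xb; rewrite -ball_normE /= => xa xb.
  have -> : x - (a + t *: (b - a)) = (1 - t) *: (x - a) + t *: (x - b).
    by apply/rowP => j; rewrite !mxE; ring.
  apply: le_lt_trans (ler_normD _ _) _; rewrite !normrZ.
  rewrite [`|t|]ger0_norm // ger0_norm ?subr_ge0 //.
  have -> : r = (1 - t) * r + t * r by rewrite -mulrDl subrK mul1r.
  have [->|tn0] := eqVneq t 0; first by rewrite subr0 !mul0r !addr0 !mul1r.
  apply: ler_ltD; first by rewrite ler_wpM2l ?subr_ge0 // ltW.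
  by rewrite ltr_pM2l // lt_def tn0.
apply: norm_rV_le => [|j]; first by rewrite mulr_ge0.
have dfj y : ball x r y -> differentiable (fun z => f z 0 j : R) y.
  move=> /df dfy.
  exact: (differentiable_comp dfy (differentiable_coord _ _ _)).
have [t t01] := mean_value (fun t t01 => dfj _ (seg t t01)).
rewrite -differential_rV; last exact/df/seg.
rewrite !mxE => ->.
exact: le_trans (coord_le_norm _ _) (dfc _ _ (seg t t01)).
Qed.

Lemma open_preimage_on (S T : topologicalType) (U : set S) (V : set T) (f : S -> T) :
  open U -> (forall x, U x -> {for x, continuous f}) -> open V ->
  open (U `&` f @^-1` V).
Proof.
move=> oU cf oV; rewrite openE => x [Ux Vfx] /=.
apply: filterI; first exact: open_nbhs_nbhs.
by apply: cf => //; exact: open_nbhs_nbhs.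
Qed.

(** Since [phi (psi y) = y], the error [psi y - psi z - L (y - z)] is [- L] applied to the
    first-order error of [phi] at [psi z]. That error is small compared with [psi y - psi z], hence
    with [y - z] by the Lipschitz bound. *)
Lemma is_diff_section (V W : normedModType R) (phi : V -> W) (psi : W -> V) z
    (L : {linear W -> V}) (c : R) : 0 < c ->
    differentiable phi (psi z) -> continuous L ->
    cancel (differential phi (psi z)) L ->
    (\forall z' \near z, phi (psi z') = z') ->
    (\forall z' \near z, `|psi z' - psi z| <= c * `|z' - z|) ->
  is_diff z psi L.
Proof.
move=> c0 dphi cL LK psiK lip; apply: is_diff_eps => // e e0.
have [C C0 LC] := linear_lipschitz cL.
(* [C] is a Lipschitz constant of [L] and [c] one of [psi] at [z]; multiplied by both, this
   tolerance becomes [e]. *)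
have e'0 : 0 < e / (c * C) by rewrite divr_gt0 // mulr_gt0.
have cpsi : psi z' @[z' --> z] --> psi z.
  apply/cvgrPdist_le => d d0; have dc0 : 0 < d / c by rewrite divr_gt0.
  near=> y; rewrite distrC.
  apply: (@le_trans _ _ (c * `|y - z|)); first by near: y.
  rewrite -ler_pdivlMl // mulrC; near: y.
  exact: cvgr_distC_le.
have := differential_eps dphi e'0 => /cpsi; rewrite near_simpl => H.
have psiz := nbhs_singleton psiK.
near=> y.
have yE : phi (psi y) = y by near: y.
have lipy : `|psi y - psi z| <= c * `|y - z| by near: y.
have : `|phi (psi y) - phi (psi z) - differential phi (psi z) (psi y - psi z)|
       <= e / (c * C) * `|psi y - psi z| by near: y; exact: H.
rewrite yE psiz => Hy.
have -> : psi y - psi z - L (y - z) =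
          - L (y - z - differential phi (psi z) (psi y - psi z)).
  by rewrite [in RHS]linearB LK opprB.
rewrite normrN; apply: le_trans (LC _) _.
have -> : e * `|y - z| = C * (e / (c * C) * (c * `|y - z|)).
  by field; rewrite !gt_eqF.
rewrite ler_pM2l //; apply: le_trans Hy _.
by rewrite ler_pM2l.
Unshelve. all: by end_near. Qed.

(** * Local inverse of a map whose differential at a point is the identity *)

Section LocalInverse.
Context {m : nat}.
Variables (phi : 'rV[R]_m -> 'rV[R]_m) (U : set 'rV[R]_m) (y0 : 'rV[R]_m).
Hypotheses (oU : open U) (Uy0 : U y0) (sphi : smooth_on U phi)
  (dphi0 : forall v, differential phi y0 v = v).

Let dphi y : U y -> differentiable phi y.
Proof. by move=> Uy; have [d _] := sphi 1; exact: d. Qed.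

Let g y := y - phi y.

Let dg y : U y -> differentiable g y.
Proof. by move=> Uy; apply: differentiableB => //; exact: dphi. Qed.

Let dgE y v : U y -> differential g y v = v - differential phi y v.
Proof.
move=> Uy; rewrite differentialB ?differential_id //; exact: dphi.
Qed.

Lemma near_identity : exists2 r : R, 0 < r &
  forall y, ball y0 r y -> U y /\ forall v, `|v - differential phi y v| <= 2^-1 * `|v|.
Proof.
(* Bounding a linear map by its values on the [m] basis vectors costs a factor [m]; [m.+1] keeps the
   denominator nonzero for [m = 0]. *)
have c0 : 0 < (m.+1%:R * 2)^-1 :> R by rewrite invr_gt0 mulr_gt0.
have near1 (i : 'I_m) : \forall y \near y0,
    U y -> `|differential g y (delta_mx 0 i)| <= (m.+1%:R * 2)^-1.
  have [_ /(_ (delta_mx 0 i))/(_ y0 Uy0) cdi] := sphi 1.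
  move/cvgrPdist_le : cdi => /(_ _ c0); apply: filterS => y.
  rewrite (derive_differential _ (dphi Uy0)).
  by rewrite dphi0 => H Uy; rewrite (dgE _ Uy) -(derive_differential _ (dphi Uy)).
have nearU : \forall y \near y0, U y by exact: open_nbhs_nbhs.
have nearall : \forall y \near y0, forall i : 'I_m,
    U y -> `|differential g y (delta_mx 0 i)| <= (m.+1%:R * 2)^-1.
  exact: (filter_forall (f := fun i => [set y | U y ->
    `|differential g y (delta_mx 0 i)| <= (m.+1%:R * 2)^-1]) _ near1).
have [r /= r0 rP] := (nbhs_ballP _ _).1 (filterI nearU nearall).
exists r => // y /rP[Uy gy]; split=> // v; rewrite -dgE //.
apply: le_trans (linear_rV_norm v (fun i => gy i Uy)) _.
apply: ler_wpM2r => //; rewrite invfM mulrA.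
rewrite -[leRHS]mul1r ler_wpM2r // ?invr_ge0 //.
by rewrite ler_pdivrMr // mul1r ler_nat.
Qed.

Variable r : R.
Hypotheses (r0 : 0 < r) (rP : forall y, ball y0 r y ->
  U y /\ forall v, `|v - differential phi y v| <= 2^-1 * `|v|).

Lemma g_contract a b : ball y0 r a -> ball y0 r b ->
  `|(b - phi b) - (a - phi a)| <= 2^-1 * `|b - a|.
Proof.
move=> Ba Bb; apply: (@ball_lipschitz _ _ g y0 r) => //.
  by move=> y /rP[Uy _]; exact: dg.
by move=> y v /rP[Uy dv]; rewrite dgE.
Qed.

(** [b - a] is the sum of the increments of [y - phi y] and of [phi], and the former is at most half
    of it. So [phi] is injective on the ball, with an inverse that is Lipschitz of constant 2. *)
Lemma phi_expand a b : ball y0 r a -> ball y0 r b ->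
  `|b - a| <= 2 * `|phi b - phi a|.
Proof.
move=> Ba Bb; have := g_contract Ba Bb.
have -> : b - phi b - (a - phi a) = (b - a) - (phi b - phi a).
  by apply/rowP => j; rewrite !mxE; ring.
have := ler_normD (b - a - (phi b - phi a)) (phi b - phi a).
rewrite subrK; lra.
Qed.

(** A solution is a fixed point of [y |-> y - phi y + z] on the closed ball of radius [r / 2]. The
    map moves [y0] by less than [r / 4] and halves distances, so it sends this ball into itself;
    hence the radius [r / 4] for [z]. *)
Lemma local_section z : ball (phi y0) (r / 4) z -> exists2 y, ball y0 r y & phi y = z.
Proof.
move=> Vz; pose D := [set y : 'rV[R]_m | `|y0 - y| <= r / 2].
have DB y : D y -> ball y0 r y.
  rewrite /D -ball_normE /= => /le_lt_trans; apply.
  by rewrite ltr_pdivrMr // ltr_pMr // ltr1n.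
have DT : {homo (fun y => y - phi y + z) : y / D y >-> D y}.
  move=> y Dy; have By := DB _ Dy.
  have B0 : ball y0 r y0 by exact: ballxx.
  have := g_contract B0 By; move: Vz Dy; rewrite /D -ball_normE /= => Vz Dy G.
  have -> : y0 - (y - phi y + z) = (phi y0 - z) - (y - phi y - (y0 - phi y0)).
    by apply/rowP => j; rewrite !mxE; ring.
  apply: le_trans (ler_normB _ _) _.
  rewrite distrC in Dy; lra.
pose F := mkfun_fun DT.
have cF : is_contraction F.
  have h0 : (0 <= 2^-1 :> R) by rewrite invr_ge0.
  exists (NngNum h0); split => /=; first by rewrite invf_lt1 ?ltr1n.
  move=> [a b] [/= Da Db]; have := g_contract (DB _ Db) (DB _ Da).
  apply: le_trans; rewrite le_eqVlt; apply/orP; left; apply/eqP; congr `|_|.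
  rewrite (_ : mkfun DT a = a - phi a + z) // (_ : mkfun DT b = b - phi b + z) //.
  by rewrite [in LHS]opprD addrACA subrr addr0.
have clD : closed D by exact: closed_closed_ball_.
have [|y Dy yE] := banach_fixed_point cF clD.
  by exists y0; rewrite /D /= subrr normr0 divr_ge0 // ltW.
exists y; first exact: DB.
have {}yE : y = y - phi y + z by exact: yE.
by apply/esym/(addrI (y - phi y)); rewrite -yE subrK.
Qed.

Lemma jacobian_unit y : ball y0 r y -> lin1_mx (differential phi y) \in unitmx.
Proof.
move=> /rP[Uy dv]; rewrite -row_free_unit; apply: inj_row_free => v.
rewrite mul_rV_lin1 => E; have := dv v; rewrite E subr0 => H.
apply/eqP; rewrite -normr_le0; have := normr_ge0 v; lra.
Qed.

End LocalInverse.

Lemma Ck_on_det (V : normedModType R) k (O : set V) n (A : V -> 'M[R]_n) : open O ->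
  (forall i j, Ck_on k O (fun x => A x i j)) -> Ck_on k O (fun x => \det (A x)).
Proof.
move=> oO cA; rewrite /determinant; apply: Ck_on_sum => // s.
by apply: Ck_onM => //; [exact: Ck_on_cst|exact: Ck_on_prod].
Qed.

(** By Cramer's rule the entries of the inverse are cofactors divided by the determinant. *)
Lemma Ck_on_invmx (V : normedModType R) k (O : set V) n (A : V -> 'M[R]_n) :
  open O -> (forall x, O x -> A x \in unitmx) ->
  (forall i j, Ck_on k O (fun x => A x i j)) ->
  forall i j, Ck_on k O (fun x => invmx (A x) i j).
Proof.
move=> oO uA cA i j.
apply: (@eq_Ck_on _ _ _ _ _ (fun x => (\det (A x))^-1 *
    ((-1) ^+ (j + i) * \det (row' j (col' i (A x)))))) => //.
  by move=> x Ox; rewrite /invmx uA // !mxE.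
apply: Ck_onM => //.
  apply: Ck_onV => //; last exact: Ck_on_det.
  by move=> x /uA; rewrite unitmxE unitfE.
apply: Ck_onM => //; first exact: Ck_on_cst.
apply: Ck_on_det => // i' j'.
rewrite (_ : (fun x => _) = fun x => A x (lift j i') (lift i j')) //.
by apply/funext => x; rewrite !mxE.
Qed.

Lemma smooth_on_coord (V : normedModType R) n (U : set V) (f : V -> 'rV[R]_n) :
  open U -> smooth_on U f <-> forall j, smooth_on U (fun x => f x 0 j).
Proof.
move=> oU; split=> [sf j k|sf k]; first by apply: (Ck_on_rV _ _ oU).1.
by apply: (Ck_on_rV _ _ oU).2 => j; exact: sf.
Qed.

Lemma smooth_on_differential (V W : normedModType R) (U : set V) (f : V -> W) x :
  smooth_on U f -> U x -> differentiable f x.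
Proof. by move=> sf Ux; have [df _] := sf 1; exact: df. Qed.

Lemma smooth_on_derive (V W : normedModType R) (U : set V) (f : V -> W) v :
  open U -> smooth_on U f -> smooth_on U (fun x => differential f x v).
Proof.
move=> oU sf k; have [df dvf] := sf k.+1.
apply: eq_Ck_on (dvf v) => // x Ux; apply: derive_differential; exact: df.
Qed.

(* The fibrewise values of [h] are those of [h \o phi] at the local section
   [psi] of [phi], and [psi] is Lipschitz by [phi_expand]; the formula for the
   derivative of [h] then has the same form as the hypothesis on [h], so that
   the order of differentiability can be raised by induction. *)
Lemma smooth_on_descent_id m (phi : 'rV[R]_m -> 'rV[R]_m) (U : set 'rV[R]_m) y0 :
    open U -> U y0 -> smooth_on U phi -> (forall v, differential phi y0 v = v) ->
  exists V : set 'rV[R]_m, [/\ open V, V (phi y0) &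
    forall h : 'rV[R]_m -> R, smooth_on U (h \o phi) -> smooth_on V h].
Proof.
move=> oU Uy0 sphi dphi0.
have [r r0 rP] := near_identity oU Uy0 sphi dphi0.
have r40 : 0 < r / 4 by rewrite divr_gt0.
pose V := ball (phi y0) (r / 4).
pose O := ball y0 r `&` phi @^-1` V.
have BU y : ball y0 r y -> U y by move=> /rP[].
have dphi y : ball y0 r y -> differentiable phi y.
  by move=> /BU; exact: smooth_on_differential.
have oB : open (ball y0 r) by exact: ball_open.
have oV : open V by exact: ball_open.
have oO : open O.
  by apply: open_preimage_on => // y /dphi; exact: differentiable_continuous.
have OU : O `<=` U by move=> y [/BU].
have OB y : O y -> ball y0 r y by case.
have expand := phi_expand sphi rP.
have /choice[psi psiP] z : exists y, V z -> O y /\ phi y = z.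
  have [Vz|nVz] := pselect (V z); last by exists 0.
  have [y By yz] := local_section sphi r0 rP Vz.
  by exists y; split=> //; split=> //; rewrite /preimage /= yz.
have psiK y : O y -> psi (phi y) = y.
  move=> Oy; have [Opy pE] := psiP (phi y) Oy.2.
  have := expand _ _ (OB _ Oy) (OB _ Opy); rewrite pE subrr normr0 mulr0.
  by rewrite normr_le0 subr_eq0 => /eqP.
pose M y := lin1_mx (differential phi y).
have uM y : O y -> M y \in unitmx by move=> Oy; exact: (jacobian_unit rP (OB _ Oy)).
have dpsi y : O y -> is_diff (phi y) psi (mulmxr (invmx (M y))).
  move=> Oy; pose L : {linear 'rV[R]_m -> 'rV[R]_m} := mulmxr (invmx (M y)).
  have nearV : \forall z \near phi y, V z.
    by apply: open_nbhs_nbhs; split=> //; case: Oy.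
  have cancelL : cancel (differential phi y) L.
    by move=> u; rewrite /= -[differential _ _ _]mul_rV_lin1 mulmxK // uM.
  apply: (@is_diff_section _ _ phi psi (phi y) L 2) => //.
  - by rewrite psiK //; exact/dphi/OB.
  - exact: linear_rV_continuous.
  - by rewrite psiK.
  - by apply: filterS nearV => z /psiP[].
  - apply: filterS nearV => z Vz; have [Opz pE] := psiP z Vz.
    by rewrite psiK //; have := expand _ _ (OB _ Oy) (OB _ Opz); rewrite pE.
have dh (h : 'rV[R]_m -> R) y w : differentiable (h \o phi) y -> O y ->
    differentiable h (phi y) /\
    differential h (phi y) w = differential (h \o phi) y (w *m invmx (M y)).
  move=> dH Oy; have [dps _] := dpsi y Oy.
  have hE : \forall z \near phi y, ((h \o phi) \o psi) z = h z.
    have nearV : \forall z \near phi y, V z by apply: open_nbhs_nbhs; split=> //; case: Oy.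
    by apply: filterS nearV => z /psiP[_ /= ->].
  have dHp : differentiable (h \o phi) (psi (phi y)) by rewrite psiK.
  have dc : differentiable ((h \o phi) \o psi) (phi y) by exact: differentiable_comp.
  split; first exact: near_eq_differentiable hE dc.
  rewrite -(near_eq_differential _ hE dc) (differential_comp _ dps dHp) psiK //.
  by rewrite (differential_is_diff _ (dpsi y Oy)).
exists V; split=> //; first exact: ballxx.
(* The hypothesis keeps all orders of [h \o phi] and only the order of [h] is counted, so the
   induction hypothesis applies to the directional derivatives of [h]. *)
suff main (k : nat) (h : 'rV[R]_m -> R) : smooth_on O (h \o phi) -> Ck_on k V h.
  by move=> h sh k; apply: main => j; exact: Ck_on_sub OU (sh j).
elim: k h => [|k IH] h sh.
  move=> z /psiP[Oy <-]; apply: differentiable_continuous.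
  have dH := smooth_on_differential sh Oy.
  by have [] := dh h (psi z) 0 dH Oy.
apply/Ck_onS; split=> [z /psiP[Oy <-]|w].
  have dH := smooth_on_differential sh Oy.
  by have [] := dh h (psi z) 0 dH Oy.
apply: IH => j; pose e i : 'rV[R]_m := delta_mx 0 i.
apply: (@eq_Ck_on _ _ _ _ _ (fun y => \sum_i (\sum_l w 0 l * invmx (M y) l i) *
    differential (h \o phi) y (e i))) => //.
  move=> y Oy /=; have dH := smooth_on_differential sh Oy.
  have [dhy dhE] := dh h y w dH Oy.
  rewrite derive_differential // dhE [in RHS](row_sum_delta (w *m _)) linear_sum.
  by apply: eq_bigr => i _; rewrite linearZ mxE.
apply: Ck_on_sum => // i; apply: Ck_onM => //; last exact: smooth_on_derive.
apply: Ck_on_sum => // l; apply: Ck_onM => //; first exact: Ck_on_cst.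
apply: Ck_on_invmx => // {}i {}l.
rewrite (_ : (fun x => _) = fun x => differential phi x (e i) 0 l); last first.
  by apply/funext => x; rewrite mxE.
apply: (Ck_on_rV _ _ oO).1; apply: smooth_on_derive => // k'.
exact: Ck_on_sub OU (sphi k').
Qed.

Lemma is_diff_affine n m (x0 : 'rV[R]_n) (S : 'M[R]_(m, n)) (w : 'rV[R]_m) :
  is_diff w (fun w => x0 + w *m S) (mulmxr S).
Proof.
have cS : continuous (mulmxr S : 'rV[R]_m -> 'rV[R]_n) by exact: linear_rV_continuous.
have dS : is_diff w (mulmxr S) (mulmxr S).
  by apply: DiffDef; [exact: linear_differentiable|rewrite diff_lin].
by have := is_diffD (is_diff_cst x0 w) dS; rewrite add0r.
Qed.

(** Preimages of the basis vectors under the differential span an affine slice [a] through [x0] on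
    which [f] has identity differential. Smoothness of [h \o f] restricts to the slice, which
    reduces the claim to equal dimensions. *)
Lemma smooth_on_descent n m p (f : 'rV[R]_n -> 'rV[R]_m) (U : set 'rV[R]_n) x0 :
    open U -> U x0 -> smooth_on U f ->
    (forall w, exists v, differential f x0 v = w) ->
  exists V : set 'rV[R]_m, [/\ open V, V (f x0) &
    forall h : 'rV[R]_m -> 'rV[R]_p, smooth_on U (h \o f) -> smooth_on V h].
Proof.
move=> oU Ux0 sf surj.
have /choice[v vE] (i : 'I_m) := surj (delta_mx 0 i).
pose S := \matrix_(i < m) v i.
pose a (w : 'rV[R]_m) := x0 + w *m S.
have da w : is_diff w a (mulmxr S) by exact: is_diff_affine.
have ca w : {for w, continuous a}.
  by case: (da w) => d _; exact: differentiable_continuous.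
pose Ua := a @^-1` U.
have oUa : open Ua by apply: open_comp => // w _; exact: ca.
have a0 : a 0 = x0 by rewrite /a mul0mx addr0.
have Ua0 : Ua 0 by rewrite /Ua /preimage /= a0.
have sa (q : nat) (g : 'rV[R]_n -> 'rV[R]_q) : smooth_on U g -> smooth_on Ua (g \o a).
  by move=> sg k; apply: Ck_on_affine_comp (sg k).
have dfa w : differential (f \o a) 0 w = w.
  have [da0 _] := da 0; have dfx : differentiable f (a 0).
    by rewrite a0; exact: smooth_on_differential Ux0.
  rewrite (differential_comp _ da0 dfx) (differential_is_diff _ (da 0)) a0 /=.
  rewrite [RHS](row_sum_delta w) {1}(row_sum_delta w) mulmx_suml linear_sum.
  apply: eq_bigr => i _; rewrite -scalemxAl linearZ -rowE rowK; congr (_ *: _).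
  exact: vE.
have [V [oV V0 VP]] := smooth_on_descent_id oUa Ua0 (sa _ _ sf) dfa.
exists V; rewrite /= a0 in V0; split=> // h sh.
apply/(smooth_on_coord _ oV) => j; apply: VP => k.
have := sa _ _ sh k; move/(Ck_on_rV _ _ oUa)/(_ j); exact.
Qed.

End InverseFunction.

(** * Smooth maps of manifolds *)

HB.lock Definition tmap (R : realType) (S T : topologicalType) (n m : nat)
    (A : manifold R S n) (B : manifold R T m) (f : S -> T) (x : S) :
    'rV[R]_n -> 'rV[R]_m :=
  tangent_map A B f x.

(** In contrast to [read_in_charts], the charts are the preferred ones of arbitrary points [p] and
    [q], so that one pair of charts serves a whole neighbourhood. *)
Definition mread (R : realType) (S T : topologicalType) (n m : nat)
    (A : manifold R S n) (B : manifold R T m) (p : S) (q : T) (f : S -> T) :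
    'rV[R]_n -> 'rV[R]_m :=
  chart_at B q \o f \o cinv (chart_at A p).

Section Manifolds.
Context {R : realType}.

Lemma chart_image_open (T : topologicalType) n (c : chart R T n) (O : set T) :
  open O -> open (c @` (cdom c `&` O)).
Proof.
move=> oO.
have -> : c @` (cdom c `&` O) = c @` cdom c `&` cinv c @^-1` O.
  apply/seteqP; split=> y /=.
    by move=> [x [cx Ox] <-]; split; [exists x|rewrite /= cmapK].
  by move=> [[x cx <-]]; rewrite cmapK // => Ox; exists x.
apply: open_preimage_on => //; first exact: cimg_open.
exact: cinv_cont.
Qed.

Lemma chart_preimage_open (T : topologicalType) n (c : chart R T n) (O : set 'rV[R]_n) :
  open O -> open (cdom c `&` c @^-1` O).
Proof.
by move=> oO; apply: open_preimage_on => //; [exact: cdom_open|exact: cmap_cont].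
Qed.

Section Maps.
Context {S T : topologicalType} {n m : nat}.
Variables (A : manifold R S n) (B : manifold R T m).
Implicit Types (f g : S -> T) (p : S) (q : T).

Lemma tmap_is_linear f x : linear (tmap A B f x).
Proof. by move=> a u v; rewrite tmap.unlock /tangent_map linearP. Qed.

HB.instance Definition _ f x :=
  GRing.isLinear.Build R 'rV[R]_n 'rV[R]_m _ (tmap A B f x) (tmap_is_linear f x).

Lemma tmapE f x v :
  tmap A B f x v = differential (mread A B x (f x) f) (chart_at A x x) v.
Proof. by rewrite tmap.unlock differential.unlock. Qed.

(** Near [x] the new reading is the old one between two transition maps, which are smooth by
    [chart_at_compat]; [W] is the open set on which all three are defined. *)
Lemma mread_change p q p' q' f x (O : set 'rV[R]_n) : continuous f ->
    cdom (chart_at A p) x -> cdom (chart_at A p') x ->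
    cdom (chart_at B q) (f x) -> cdom (chart_at B q') (f x) ->
    open O -> O (chart_at A p x) -> smooth_on O (mread A B p q f) ->
  exists O' : set 'rV[R]_n,
    [/\ open O', O' (chart_at A p' x) & smooth_on O' (mread A B p' q' f)].
Proof.
move=> cf px p'x qfx q'fx oO Opx sf.
set c := chart_at A p; set c' := chart_at A p'.
set d := chart_at B q; set d' := chart_at B q'.
pose W := (cdom c `&` c @^-1` O) `&` cdom c' `&` f @^-1` cdom d `&` f @^-1` cdom d'.
have oW : open W.
  have od e : open (f @^-1` cdom (chart_at B e)).
    by apply: open_comp => [z _|]; [exact: cf|exact: cdom_open].
  apply: openI; last exact: od.
  apply: openI; last exact: od.
  by apply: openI; [exact: chart_preimage_open|exact: cdom_open].
pose O' := c' @` (cdom c' `&` W); pose O2 := c @` (cdom c `&` W).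
pose D := d @` (cdom d `&` cdom d').
have oO' : open O' by exact: chart_image_open.
have oO2 : open O2 by exact: chart_image_open.
have oD : open D by apply: chart_image_open; exact: cdom_open.
exists O'; split=> //; first by exists x => //; split=> //; do !split.
move=> k; apply: (@eq_Ck_on _ _ _ _ _
    ((d' \o cinv d) \o (mread A B p q f \o (c \o cinv c')))) => //.
  move=> _ [y [c'y [[[[cy Oy] _] dfy] d'fy]] <-] /=.
  by rewrite /mread /= !cmapK.
apply: (@Ck_on_comp _ 'rV[R]_n m m k O' D) => //.
- move=> _ [y [c'y [[[[cy Oy] _] dfy] d'fy]] <-] /=; rewrite !cmapK //.
  by exists (f y) => //; rewrite /mread /= cmapK.
- exact: chart_at_compat.
apply: (@Ck_on_comp _ 'rV[R]_n n m k O' O2) => //.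
- move=> _ [y [c'y Wy] <-] /=; rewrite !cmapK //.
  by exists y => //; split=> //; case: Wy => [[[[]]]].
- apply: Ck_on_sub (sf k) => _ [y [cy [[[[]]]]] _ Oy _ _ _ <-]; exact: Oy.
apply: Ck_on_sub (chart_at_compat A p' p k) => _ [y [c'y Wy] <-].
by exists y => //; split=> //; case: Wy => [[[[]]]].
Qed.

Lemma smooth_continuous f : smooth A B f -> continuous f.
Proof. by case. Qed.

Lemma smooth_mread f p q : smooth A B f ->
  smooth_on (chart_at A p @` (cdom (chart_at A p) `&` f @^-1` cdom (chart_at B q)))
            (mread A B p q f).
Proof.
move=> [cf sf] k; apply: Ck_on_local => _ [x [px qfx] <-].
have [] := @mread_change x (f x) p q f x _ cf (chart_at_mem _ _) px
  (chart_at_mem _ _) qfx _ _ (sf x).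
- apply: chart_image_open; apply: open_comp => [z _|]; first exact: cf.
  exact: cdom_open.
- by exists x => //; split; exact: chart_at_mem.
by move=> Q' [_ Q'x sQ']; exists Q'.
Qed.

Lemma mread_dom_open f p q : continuous f ->
  open (chart_at A p @` (cdom (chart_at A p) `&` f @^-1` cdom (chart_at B q))).
Proof.
move=> cf; apply: chart_image_open; apply: open_comp => [z _|]; first exact: cf.
exact: cdom_open.
Qed.

Lemma mread_differentiable f p q x : smooth A B f ->
  cdom (chart_at A p) x -> cdom (chart_at B q) (f x) ->
  differentiable (mread A B p q f) (chart_at A p x).
Proof.
move=> sf px qfx; apply: smooth_on_differential (smooth_mread p q sf) _.
by exists x.
Qed.

Lemma smooth_local f : continuous f ->
  (forall x, exists p q, [/\ cdom (chart_at A p) x, cdom (chart_at B q) (f x) &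
    exists O : set 'rV[R]_n,
      [/\ open O, O (chart_at A p x) & smooth_on O (mread A B p q f)]]) ->
  smooth A B f.
Proof.
move=> cf H; split=> // x k; apply: Ck_on_local => _ [y [xy fxy] <-].
have [p [q [py qfy [Q [oQ Qpy sQ]]]]] := H y.
have [Q' [_ Q'y sQ']] := mread_change cf py xy qfy fxy oQ Qpy sQ.
by exists Q'.
Qed.

Lemma smooth_cst (b : T) : smooth A B (fun=> b).
Proof.
apply: smooth_local => [|x]; first exact: cst_continuous.
exists x, b; split; [exact: chart_at_mem|exact: chart_at_mem|].
exists setT; split=> //; first exact: openT.
by move=> k; exact: Ck_on_cst.
Qed.

Lemma near_chart p q f x : continuous f ->
  cdom (chart_at A p) x -> cdom (chart_at B q) (f x) ->
  \forall y \near chart_at A p x, exists z,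
    [/\ cdom (chart_at A p) z, cdom (chart_at B q) (f z), chart_at A p z = y &
      cinv (chart_at A p) y = z].
Proof.
move=> cf px qfx; have oD := @mread_dom_open f p q cf.
have : \forall y \near chart_at A p x,
    (chart_at A p @` (cdom (chart_at A p) `&` f @^-1` cdom (chart_at B q))) y.
  by apply: open_nbhs_nbhs; split=> //; exists x.
by apply: filterS => _ [z [pz qz] <-]; exists z; split=> //; rewrite cmapK.
Qed.

Lemma near_cdom p x : cdom (chart_at A p) x -> \forall y \near x, cdom (chart_at A p) y.
Proof. by move=> px; apply: open_nbhs_nbhs; split=> //; exact: cdom_open. Qed.

End Maps.

Section Composition.
Context {S T U : topologicalType} {n m l : nat}.
Variables (A : manifold R S n) (B : manifold R T m) (D : manifold R U l).

Lemma mread_comp (f : S -> T) (g : T -> U) p q r x : continuous f ->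
  cdom (chart_at A p) x -> cdom (chart_at B q) (f x) ->
  \forall y \near chart_at A p x,
    (mread B D q r g \o mread A B p q f) y = mread A D p r (g \o f) y.
Proof.
move=> cf px qfx; apply: filterS (near_chart cf px qfx) => y.
by move=> [z [pz qfz <- E]]; rewrite /mread /= E cmapK.
Qed.

(** The charts are arbitrary, so the case where [f] or [g] is the identity is the rule for changing
    charts at the source or at the target. *)
Lemma differential_mread_comp (f : S -> T) (g : T -> U) p q r x v :
  smooth A B f -> smooth B D g ->
  cdom (chart_at A p) x -> cdom (chart_at B q) (f x) -> cdom (chart_at D r) (g (f x)) ->
  differential (mread A D p r (g \o f)) (chart_at A p x) v =
  differential (mread B D q r g) (chart_at B q (f x))
    (differential (mread A B p q f) (chart_at A p x) v).
Proof.
move=> sf sg px qfx rgfx.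
have df := mread_differentiable sf px qfx.
have dg := mread_differentiable sg qfx rgfx.
have E : mread A B p q f (chart_at A p x) = chart_at B q (f x).
  by rewrite /mread /= cmapK.
rewrite -E in dg *.
rewrite -(near_eq_differential _ (mread_comp g r (smooth_continuous sf) px qfx)).
  exact: differential_comp.
exact: differentiable_comp.
Qed.

Lemma tmap_comp (f : S -> T) (g : T -> U) x v :
  smooth A B f -> smooth B D g ->
  tmap A D (g \o f) x v = tmap B D g (f x) (tmap A B f x v).
Proof.
move=> sf sg; rewrite !tmapE.
by apply: differential_mread_comp => //; exact: chart_at_mem.
Qed.

Lemma smooth_comp (f : S -> T) (g : T -> U) :
  smooth A B f -> smooth B D g -> smooth A D (g \o f).
Proof.
move=> sf sg; have [cf cg] := (smooth_continuous sf, smooth_continuous sg).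
apply: smooth_local => [z|x]; first by apply: continuous_comp; [exact: cf|exact: cg].
exists x, (g (f x)); split; [exact: chart_at_mem|exact: chart_at_mem|].
set c := chart_at A x; set d := chart_at B (f x); set e := chart_at D (g (f x)).
pose W := f @^-1` cdom d `&` (g \o f) @^-1` cdom e.
have oW : open W.
  apply: openI; apply: open_comp => [z _|]; [exact: cf|exact: cdom_open| |exact: cdom_open].
  by apply: continuous_comp; [exact: cf|exact: cg].
exists (c @` (cdom c `&` W)); split.
- exact: chart_image_open.
- by exists x => //; split; [exact: chart_at_mem|split; exact: chart_at_mem].
move=> k; apply: (@eq_Ck_on _ _ _ _ _ (mread B D (f x) (g (f x)) g \o mread A B x (f x) f)).
- exact: chart_image_open.
- by move=> _ [z [cz [fz gfz]] <-]; rewrite /mread /= cmapK // cmapK.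
apply: (@Ck_on_comp _ 'rV[R]_n m l k _ (d @` (cdom d `&` g @^-1` cdom e))).
- exact: chart_image_open.
- apply: chart_image_open; apply: open_comp => [z _|]; first exact: cg.
  exact: cdom_open.
- move=> _ [z [cz [fz gfz]] <-]; rewrite /mread /= cmapK //.
  by exists (f z).
- exact: smooth_mread.
apply: Ck_on_sub (smooth_mread x (f x) sf k) => _ [z [cz [fz gfz]] <-].
by exists z.
Qed.

End Composition.

Section Identity.
Context {S : topologicalType} {n : nat}.
Variable A : manifold R S n.

Lemma smooth_id : smooth A A id.
Proof.
apply: smooth_local => [z|x]; first exact: cvg_id.
exists x, x; split; [exact: chart_at_mem|exact: chart_at_mem|].
exists (chart_at A x @` cdom (chart_at A x)); split.
- exact: cimg_open.
- by exists x => //; exact: chart_at_mem.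
move=> k; apply: (@eq_Ck_on _ _ _ _ _ idfun); first exact: cimg_open.
  by move=> _ [z cz <-]; rewrite /mread /= cmapK.
pose L : {linear 'rV[R]_n -> 'rV[R]_n} := idfun.
apply: (@Ck_on_linear R 'rV[R]_n 'rV[R]_n k _ L).
exact: linear_rV_continuous.
Qed.

Lemma tmap_id x v : tmap A A id x v = v.
Proof.
rewrite tmapE.
have E : \forall y \near chart_at A x x, idfun y = mread A A x x id y.
  have cA := chart_at_mem A x.
  apply: filterS (near_chart (f := id) _ cA cA) => [y|z]; last exact: cvg_id.
  by move=> [z [_ _ <- E]]; rewrite /mread /= E.
rewrite -(near_eq_differential _ E); first exact: differential_id.
by have [] := is_diff_id (chart_at A x x).
Qed.

End Identity.

Lemma tmap_cst (S T : topologicalType) n m (A : manifold R S n) (B : manifold R T m)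
  (b : T) x v : tmap A B (fun=> b) x v = 0.
Proof.
rewrite tmapE (_ : mread _ _ _ _ _ = fun=> chart_at B b b) //.
exact: differential_cst.
Qed.

(** [tmap] at a point [z] uses the charts of [z] and [f z], whereas a constancy argument needs the
    fixed charts of [x] and [f x]. Composing with identities on both sides changes charts, so the
    fixed reading has zero differential on a ball, and is Lipschitz there with constant 0. *)
Lemma tmap0_locally_constant (S T : topologicalType) n m (A : manifold R S n)
    (B : manifold R T m) (f : S -> T) : smooth A B f ->
  (forall x v, tmap A B f x v = 0) -> forall x, \forall y \near x, f y = f x.
Proof.
move=> sf tf0 x; have cf := smooth_continuous sf.
have [cx dx] := (chart_at_mem A x, chart_at_mem B (f x)).
set c := chart_at A x; set d := chart_at B (f x).
pose g := mread A B x (f x) f.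
have [r /= r0 rP] := (nbhs_ballP _ _).1 (near_chart cf cx dx).
have dg0 y v : ball (c x) r y -> differential g y v = 0.
  move=> /rP[z [cz dz <- _]].
  have -> : differential g (chart_at A x z) v =
    differential (mread A B x (f x) (f \o id)) (chart_at A x z) v by [].
  rewrite (differential_mread_comp (q := z) _ (smooth_id A) sf) //; last exact: chart_at_mem.
  set w := differential _ _ v.
  have -> : differential (mread A B z (f x) f) (chart_at A z z) w =
    differential (mread A B z (f x) (id \o f)) (chart_at A z z) w by [].
  rewrite (differential_mread_comp (q := f z) _ sf (smooth_id B)) //; try exact: chart_at_mem.
  by rewrite -tmapE tf0 linear0.
have gcst y : ball (c x) r y -> g y = g (c x).
  move=> By; apply/eqP; rewrite -subr_eq0 -normr_le0.
  rewrite -(mul0r `|y - c x|); apply: (ball_lipschitz (x := c x) (r := r)) => //.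
  - move=> _ /rP[z [cz dz <- _]]; exact: mread_differentiable.
  - by move=> z v /dg0 ->; rewrite normr0 mul0r.
  - exact: ballxx.
have nearB : \forall y \near x, ball (c x) r (c y).
  by apply: (cmap_cont cx); exact: nbhsx_ballx.
have nearD : \forall y \near x, cdom d (f y).
  by apply: cf; apply: open_nbhs_nbhs; split=> //; exact: cdom_open.
apply: filterS3 (near_cdom cx) nearB nearD => y cy By dy.
have := gcst _ By; rewrite /g /mread /= !cmapK // => E.
by rewrite -[LHS](cmapK dy) E cmapK.
Qed.

End Manifolds.

(** * Lie groups *)

Section ProductRule.
Context {R : realType} {V : normedModType R}.

Lemma differentialZ n (u : V -> R) (w : V -> 'rV[R]_n) x v :
  differentiable u x -> differentiable w x ->
  differentiable (fun y => u y *: w y) x /\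
  differential (fun y => u y *: w y) x v =
    u x *: differential w x v + differential u x v *: w x.
Proof.
move=> du dw.
have dwj j : differentiable (fun y => w y 0 j : R) x.
  exact: (differentiable_comp dw (differentiable_coord _ _ _)).
have cE j : (fun y => (u y *: w y) 0 j) = u * (fun y => w y 0 j).
  by apply/funext => y; rewrite mxE.
have duw : differentiable (fun y => u y *: w y) x.
  by apply: differentiable_rV => j; rewrite cE; exact: differentiableM.
split=> //; apply/rowP => j; rewrite differential_rV // cE !mxE.
rewrite differential_rV // differential.unlock diffM //=.
by congr (_ + _); exact: mulrC.
Qed.

Lemma differential_sum n (I : Type) (r : seq I) (F : I -> V -> 'rV[R]_n) x v :
  (forall i, differentiable (F i) x) ->
  differentiable (fun y => \sum_(i <- r) F i y) x /\
  differential (fun y => \sum_(i <- r) F i y) x v =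
    \sum_(i <- r) differential (F i) x v.
Proof.
move=> dF; elim: r => [|i r [IHd IHe]].
  have -> : (fun y => \sum_(i <- [::]) F i y) = fun=> 0.
    by apply/funext => y; rewrite big_nil.
  by rewrite big_nil differential_cst; split=> //; exact: differentiable_cst.
have -> : (fun y => \sum_(j <- i :: r) F j y) = fun y => F i y + \sum_(j <- r) F j y.
  by apply/funext => y; rewrite big_cons.
rewrite big_cons differentialD // IHe; split=> //.
exact: differentiableD.
Qed.

(** Product rule when both the coefficients and the vectors vary: it serves to differentiate a
    bracket of two varying vectors, the second one being expanded in coordinates. *)
Lemma differential_lincomb n m (F : 'I_n -> V -> 'rV[R]_m) (g : V -> 'rV[R]_n) x v :
  (forall i, differentiable (F i) x) -> differentiable g x ->
  differentiable (fun y => \sum_i g y 0 i *: F i y) x /\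
  differential (fun y => \sum_i g y 0 i *: F i y) x v =
    \sum_i g x 0 i *: differential (F i) x v + \sum_i differential g x v 0 i *: F i x.
Proof.
move=> dF dg.
have dgi i : differentiable (fun y => g y 0 i : R) x.
  exact: (differentiable_comp dg (differentiable_coord _ _ _)).
have dgF i := (differentialZ v (dgi i) (dF i)).1.
have [d ->] := @differential_sum _ _ (index_enum 'I_n) _ x v dgF; split=> //.
rewrite -big_split; apply: eq_bigr => i _ /=.
by rewrite (differentialZ v (dgi i) (dF i)).2 differential_rV.
Qed.

End ProductRule.

HB.lock Definition AdL (R : realType) (G : groupWithTopologyType) (n : nat)
    (A : manifold R G n) (g : G) : 'rV[R]_n -> 'rV[R]_n := Ad A g.

HB.lock Definition bracket (R : realType) (G : groupWithTopologyType) (n : nat)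
    (A : manifold R G n) (X : 'rV[R]_n) : 'rV[R]_n -> 'rV[R]_n := lie_bracket A X.

Section LieGroup.
Context {R : realType} {G : groupWithTopologyType} {n : nat} {A : manifold R G n}.
Hypothesis hG : lie_group A.

Let mul_continuous : continuous (fun z : G * G => (z.1 * z.2)%g).
Proof. by case: hG. Qed.

Lemma mul_for_continuous (S : topologicalType) (f1 f2 : S -> G) x :
  {for x, continuous f1} -> {for x, continuous f2} ->
  {for x, continuous (fun y => (f1 y * f2 y)%g)}.
Proof.
move=> c1 c2.
apply: (@continuous_comp _ _ _ (fun y => (f1 y, f2 y)) (fun z : G * G => (z.1 * z.2)%g)).
  exact: cvg_pair.
exact: mul_continuous.
Qed.

Definition mul_chart (a b : G) (z : 'rV[R]_n * 'rV[R]_n) : 'rV[R]_n :=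
  chart_at A (a * b)%g (cinv (chart_at A a) z.1 * cinv (chart_at A b) z.2)%g.

Definition mul_chart_dom (a b : G) : set ('rV[R]_n * 'rV[R]_n) :=
  [set z | [/\ (chart_at A a @` cdom (chart_at A a)) z.1,
               (chart_at A b @` cdom (chart_at A b)) z.2 &
               cdom (chart_at A (a * b)%g)
                 (cinv (chart_at A a) z.1 * cinv (chart_at A b) z.2)%g]].

Lemma mul_chart_dom_open a b : open (mul_chart_dom a b).
Proof.
have oU : open ((chart_at A a @` cdom (chart_at A a)) `*`
                (chart_at A b @` cdom (chart_at A b))).
  rewrite openE => z [z1 z2]; exists (chart_at A a @` cdom (chart_at A a),
    chart_at A b @` cdom (chart_at A b)) => //.
  by split; apply: open_nbhs_nbhs; split=> //; exact: cimg_open.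
have -> : mul_chart_dom a b = ((chart_at A a @` cdom (chart_at A a)) `*`
      (chart_at A b @` cdom (chart_at A b))) `&`
    (fun z => (cinv (chart_at A a) z.1 * cinv (chart_at A b) z.2)%g) @^-1`
      cdom (chart_at A (a * b)%g).
  by apply/seteqP; split=> z; [case=> *; split|case=> -[] *; split].
apply: open_preimage_on => // [z [z1 z2]|]; last exact: cdom_open.
apply: mul_for_continuous.
  apply: (@continuous_comp _ _ _ fst (cinv (chart_at A a))); first exact: cvg_fst.
  exact: cinv_cont.
apply: (@continuous_comp _ _ _ snd (cinv (chart_at A b))); first exact: cvg_snd.
exact: cinv_cont.
Qed.

Lemma mul_chart_smooth a b : smooth_on (mul_chart_dom a b) (mul_chart a b).
Proof. by case: hG => _ sm _; exact: sm. Qed.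

Lemma Ck_on_mul (V : normedModType R) k (O : set V) (f1 f2 : V -> G) a b : open O ->
  (forall y, O y -> [/\ cdom (chart_at A a) (f1 y), cdom (chart_at A b) (f2 y) &
                        cdom (chart_at A (a * b)%g) (f1 y * f2 y)%g]) ->
  Ck_on k O (chart_at A a \o f1) -> Ck_on k O (chart_at A b \o f2) ->
  Ck_on k O (fun y => chart_at A (a * b)%g (f1 y * f2 y)%g).
Proof.
move=> oO fO c1 c2.
apply: (@eq_Ck_on _ _ _ _ _ (fun y => mul_chart a b
    ((chart_at A a \o f1) y, (chart_at A b \o f2) y))) => //.
  by move=> y /fO[f1y f2y f12y]; rewrite /mul_chart /= !cmapK.
apply: (Ck_on_comp_pair oO (@mul_chart_dom_open a b)) => //.
  by move=> y /fO[f1y f2y f12y]; split => /=; [exists (f1 y)|exists (f2 y)|rewrite !cmapK].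
exact: mul_chart_smooth.
Qed.

Section SmoothMul.
Context {S : topologicalType} {m : nat} {B : manifold R S m}.
Implicit Types f : S -> G.

Lemma smooth_mul f1 f2 : smooth B A f1 -> smooth B A f2 ->
  smooth B A (fun x => (f1 x * f2 x)%g).
Proof.
move=> s1 s2; have [c1 c2] := (smooth_continuous s1, smooth_continuous s2).
have c12 : continuous (fun x => (f1 x * f2 x)%g).
  by move=> x; apply: mul_for_continuous; [exact: c1|exact: c2].
apply: smooth_local => // x; exists x, (f1 x * f2 x)%g.
split; [exact: chart_at_mem|exact: chart_at_mem|].
pose W := f1 @^-1` cdom (chart_at A (f1 x)) `&` f2 @^-1` cdom (chart_at A (f2 x))
  `&` (fun x => (f1 x * f2 x)%g) @^-1` cdom (chart_at A (f1 x * f2 x)%g).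
have oW : open W.
  by apply: openI; [apply: openI|]; apply: open_comp => [z _|];
    [exact: c1|exact: cdom_open|exact: c2|exact: cdom_open|exact: c12|exact: cdom_open].
have oO := chart_image_open (c := chart_at B x) oW.
exists (chart_at B x @` (cdom (chart_at B x) `&` W)); split=> //.
  by exists x => //; split; [|split; [split|]]; exact: chart_at_mem.
move=> k; apply: Ck_on_mul => //.
- by move=> _ [y [cy [[f1y f2y] f12y]] <-] /=; rewrite cmapK.
- by apply: Ck_on_sub (smooth_mread x (f1 x) s1 k) => _ [y [cy [[f1y f2y] f12y]] <-]; exists y.
- by apply: Ck_on_sub (smooth_mread x (f2 x) s2 k) => _ [y [cy [[f1y f2y] f12y]] <-]; exists y.
Qed.

Lemma smooth_inv f : smooth B A f -> smooth B A (fun x => (f x)^-1%g).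
Proof. by move=> sf; apply: (smooth_comp sf); case: hG. Qed.

Lemma tmap_mul_chart f1 f2 x v : smooth B A f1 -> smooth B A f2 ->
  tmap B A (fun x => (f1 x * f2 x)%g) x v =
  differential (mul_chart (f1 x) (f2 x))
    (chart_at A (f1 x) (f1 x), chart_at A (f2 x) (f2 x))
    (tmap B A f1 x v, tmap B A f2 x v).
Proof.
move=> s1 s2; have [c1 c2] := (smooth_continuous s1, smooth_continuous s2).
have xx := chart_at_mem B x.
have d1 := mread_differentiable s1 xx (chart_at_mem A (f1 x)).
have d2 := mread_differentiable s2 xx (chart_at_mem A (f2 x)).
set a := f1 x; set b := f2 x.
pose g y := (mread B A x a f1 y, mread B A x b f2 y).
have gx : g (chart_at B x x) = (chart_at A a a, chart_at A b b).
  by rewrite /g /mread /= cmapK.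
have dg : differentiable g (chart_at B x x) by exact: differentiable_pair.
have dM : differentiable (mul_chart a b) (g (chart_at B x x)).
  rewrite gx; apply: smooth_on_differential (@mul_chart_smooth a b) _.
  split; rewrite /=; [exists a|exists b|] => //; try exact: chart_at_mem.
  by rewrite !cmapK; exact: chart_at_mem.
have E : \forall y \near chart_at B x x,
    (mul_chart a b \o g) y = mread B A x (a * b)%g (fun x => (f1 x * f2 x)%g) y.
  have N1 := near_chart c1 xx (chart_at_mem A (f1 x)).
  have N2 := near_chart c2 xx (chart_at_mem A (f2 x)).
  apply: filterS2 N1 N2 => y [z [_ f1z _ zE]] [z' [_ f2z _ z'E]].
  rewrite -z'E zE in f2z.
  by rewrite /mul_chart /g /mread /= zE !cmapK.
rewrite !tmapE -(near_eq_differential _ E); last exact: differentiable_comp.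
by rewrite differential_comp // gx /g differential_pair.
Qed.

End SmoothMul.

Lemma smooth_lmul g : smooth A A (fun a => (g * a)%g).
Proof. by apply: (smooth_mul (smooth_cst _ _ _) (smooth_id A)). Qed.

Lemma smooth_conj g : smooth A A (fun a => (g * a * g^-1)%g).
Proof. exact: (smooth_mul (smooth_lmul g) (smooth_cst _ _ _)). Qed.

(** The differential of the multiplication is linear on pairs, and [(v1, v2)] is
    [(v1, 0) + (0, v2)]; each summand is the case of one constant factor. *)
Lemma tmap_mul (S : topologicalType) m (B : manifold R S m) (f1 f2 : S -> G) x v :
    smooth B A f1 -> smooth B A f2 ->
  tmap B A (fun x => (f1 x * f2 x)%g) x v =
  tmap A A (fun a => (a * f2 x)%g) (f1 x) (tmap B A f1 x v) +
  tmap A A (fun a => (f1 x * a)%g) (f2 x) (tmap B A f2 x v).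
Proof.
move=> s1 s2; rewrite tmap_mul_chart //.
rewrite (tmap_mul_chart (f1 := id) (f2 := fun=> f2 x)) ?tmap_id ?tmap_cst;
  [|exact: smooth_id|exact: smooth_cst].
rewrite (tmap_mul_chart (f1 := fun=> f1 x) (f2 := id)) ?tmap_id ?tmap_cst;
  [|exact: smooth_cst|exact: smooth_id].
rewrite -linearD; congr (differential _ _ _).
by rewrite -[RHS]/((_ + 0, 0 + _)) addr0 add0r.
Qed.

Lemma AdE g v : AdL A g v = tmap A A (fun a => (g * a * g^-1)%g) 1%g v.
Proof. by rewrite AdL.unlock tmap.unlock. Qed.

Lemma Ad_is_linear g : linear (AdL A g).
Proof. by move=> a u v; rewrite !AdE linearP. Qed.

HB.instance Definition _ g :=
  GRing.isLinear.Build R 'rV[R]_n 'rV[R]_n _ (AdL A g) (Ad_is_linear g).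

Lemma Ad1 v : AdL A 1%g v = v.
Proof.
rewrite AdE (_ : (fun a => _) = id) ?tmap_id //.
by apply/funext => a; rewrite mul1g invg1 mulg1.
Qed.

Lemma AdM g h v : AdL A (g * h)%g v = AdL A g (AdL A h v).
Proof.
rewrite !AdE.
have -> : (fun a => (g * h * a * (g * h)^-1)%g) =
    (fun a => (g * a * g^-1)%g) \o (fun a => (h * a * h^-1)%g).
  by apply/funext => a /=; rewrite invgM !mulgA.
rewrite (tmap_comp _ _ (smooth_conj h) (smooth_conj g)).
by rewrite mulg1 mulgV.
Qed.

Lemma AdK g : cancel (AdL A g) (AdL A g^-1%g).
Proof. by move=> v; rewrite -AdM mulVg Ad1. Qed.

Lemma AdVK g : cancel (AdL A g^-1%g) (AdL A g).
Proof. by move=> v; rewrite -AdM mulgV Ad1. Qed.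

End LieGroup.

(** * The Lie bracket as the derivative of [Ad] *)

Section Bracket.
Context {R : realType} {G : groupWithTopologyType} {n : nat} {A : manifold R G n}.
Hypothesis hG : lie_group A.

Local Notation c1 := (chart_at A 1%g).
Local Notation e := (c1 1%g).

Let cdom1 : cdom c1 1%g. Proof. exact: chart_at_mem. Qed.

Let cinv1 : cinv c1 e = 1%g. Proof. exact: cmapK. Qed.

Lemma Ck_on_mul1 (V : normedModType R) k (O : set V) (f1 f2 : V -> G) : open O ->
  (forall y, O y -> [/\ cdom c1 (f1 y), cdom c1 (f2 y) & cdom c1 (f1 y * f2 y)%g]) ->
  Ck_on k O (c1 \o f1) -> Ck_on k O (c1 \o f2) ->
  Ck_on k O (c1 \o (fun y => (f1 y * f2 y)%g)).
Proof.
move=> oO fO s1 s2.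
by have := @Ck_on_mul R G n A hG V k O f1 f2 1%g 1%g oO; rewrite mulg1; apply.
Qed.

(** The map [(a, b) |-> a b a^-1] in the chart at 1, with the two arguments packed in one row vector
    so that derivatives along affine slices can be taken. *)
Definition conj_chart (u : 'rV[R]_(n + n)) : 'rV[R]_n :=
  c1 (cinv c1 (lsubmx u) * cinv c1 (rsubmx u) * (cinv c1 (lsubmx u))^-1)%g.

(** [Ad] is a derivative in [b] and the bracket differentiates it again in [a], so smoothness in
    both variables jointly is needed. [O] collects the points at which all intermediate products
    stay in the chart at 1. *)
Lemma conj_chart_smooth : exists O : set 'rV[R]_(n + n),
  [/\ open O, O (row_mx e e), forall u, O u -> (c1 @` cdom c1) (lsubmx u) &
      smooth_on O conj_chart].
Proof.
pose x (u : 'rV[R]_(n + n)) := cinv c1 (lsubmx u).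
pose y (u : 'rV[R]_(n + n)) := cinv c1 (rsubmx u).
pose D := c1 @` cdom c1; have oD : open D by exact: cimg_open.
pose O1 := [set u : 'rV[R]_(n + n) | D (lsubmx u) /\ D (rsubmx u)].
have cl : continuous (lsubmx : 'rV[R]_(n + n) -> 'rV[R]_n) by exact: linear_rV_continuous.
have cr : continuous (rsubmx : 'rV[R]_(n + n) -> 'rV[R]_n) by exact: linear_rV_continuous.
have oO1 : open O1.
  apply: (@openI _ (lsubmx @^-1` D) (rsubmx @^-1` D)).
    by apply: open_comp => // u _; exact: cl.
  by apply: open_comp => // u _; exact: cr.
have cx u : O1 u -> {for u, continuous x}.
  by move=> [Du _]; apply: continuous_comp; [exact: cl|exact: cinv_cont].
have cy u : O1 u -> {for u, continuous y}.
  by move=> [_ Du]; apply: continuous_comp; [exact: cr|exact: cinv_cont].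
have sinv : smooth A A (fun a : G => a^-1%g) by case: hG.
have cxV u : O1 u -> {for u, continuous (fun u => (x u)^-1%g)}.
  by move=> /cx cu; apply: continuous_comp cu _; exact: smooth_continuous sinv _.
have cxy u : O1 u -> {for u, continuous (fun u => (x u * y u)%g)}.
  by move=> O1u; apply: (mul_for_continuous hG); [exact: cx|exact: cy].
have cxyx u : O1 u -> {for u, continuous (fun u => (x u * y u * (x u)^-1)%g)}.
  by move=> O1u; apply: (mul_for_continuous hG); [exact: cxy|exact: cxV].
pose O := (O1 `&` (fun u => (x u * y u)%g) @^-1` cdom c1) `&`
          (O1 `&` (fun u => (x u)^-1%g) @^-1` cdom c1) `&`
          (O1 `&` (fun u => (x u * y u * (x u)^-1)%g) @^-1` cdom c1).
have oO : open O.
  have oc (f : 'rV[R]_(n + n) -> G) : (forall u, O1 u -> {for u, continuous f}) ->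
      open (O1 `&` f @^-1` cdom c1).
    by move=> cf; apply: open_preimage_on => //; exact: cdom_open.
  by apply: openI; [apply: openI|]; exact: oc.
have OE u : O u -> [/\ D (lsubmx u), D (rsubmx u), cdom c1 (x u * y u)%g,
    cdom c1 (x u)^-1%g & cdom c1 (x u * y u * (x u)^-1)%g].
  by move=> [[[[? ?] ?] [_ ?]] [_ ?]].
have xE u : O u -> c1 (x u) = lsubmx u /\ cdom c1 (x u).
  by move=> /OE[[a ca aE] _ _ _ _]; rewrite /x -aE cmapK.
have yE u : O u -> c1 (y u) = rsubmx u /\ cdom c1 (y u).
  by move=> /OE[_ [a ca aE] _ _ _]; rewrite /y -aE cmapK.
have De : D e by exists 1%g.
have O1e : O1 (row_mx e e) by rewrite /O1 /= row_mxKl row_mxKr.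
have xe : x (row_mx e e) = 1%g by rewrite /x row_mxKl.
have ye : y (row_mx e e) = 1%g by rewrite /y row_mxKr.
exists O; split=> //.
- by do ![split => //]; rewrite /preimage /= xe ?ye ?invg1 ?mulg1.
- by move=> u /OE[].
move=> k.
have sx : Ck_on k O (c1 \o x).
  apply: (@eq_Ck_on _ _ _ _ _ (lsubmx : 'rV[R]_(n + n) -> 'rV[R]_n)) => //.
    by move=> u /xE[].
  by apply: Ck_on_linear; exact: cl.
have sy : Ck_on k O (c1 \o y).
  apply: (@eq_Ck_on _ _ _ _ _ (rsubmx : 'rV[R]_(n + n) -> 'rV[R]_n)) => //.
    by move=> u /yE[].
  by apply: Ck_on_linear; exact: cr.
have sxV : Ck_on k O (c1 \o (fun u => (x u)^-1%g)).
  apply: (@Ck_on_comp _ _ n n k O (c1 @` (cdom c1 `&` (fun a : G => a^-1%g) @^-1` cdom c1))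
    (mread A A 1%g 1%g (fun a : G => a^-1%g)) lsubmx) => //.
  - exact: mread_dom_open (smooth_continuous sinv).
  - move=> u Ou; have [uE xu] := xE u Ou; have [_ _ _ xVu _] := OE u Ou.
    by exists (x u).
  - exact: smooth_mread.
  - by apply: Ck_on_linear; exact: cl.
apply: Ck_on_mul1 => //; first by move=> u /OE[].
apply: Ck_on_mul1 => // u Ou; have [_ _ xyu _ _] := OE u Ou.
by split=> //; [have [] := xE u Ou|have [] := yE u Ou].
Qed.

Lemma mread_conj_differential g X :
  differential (c1 \o (fun v => (g * cinv c1 v * g^-1)%g)) e X = AdL A g X.
Proof. by rewrite AdE tmapE mulg1 mulgV. Qed.

(** [Ad] at the point with coordinates [v], applied to [Y], is the derivative of [conj_chart] at
    [(v, e)] along [(0, Y)]; the slice [i] restricts this smooth function to the second argument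
    [e]. *)
Lemma Ad_chart_smooth Y : exists N : set 'rV[R]_n,
  [/\ open N, N e & smooth_on N (fun v => AdL A (cinv c1 v) Y)].
Proof.
have [Q [oQ Qe Qdom sK]] := conj_chart_smooth.
pose i (v : 'rV[R]_n) : 'rV[R]_(n + n) := row_mx 0 e + v *m row_mx 1%:M 0.
pose j (v w : 'rV[R]_n) : 'rV[R]_(n + n) := row_mx v 0 + w *m row_mx 0 1%:M.
have iE v : i v = row_mx v e.
  by rewrite /i mul_mx_row mulmx1 mulmx0 add_row_mx add0r addr0.
have jE v w : j v w = row_mx v w.
  by rewrite /j mul_mx_row mulmx1 mulmx0 add_row_mx add0r addr0.
have di v : is_diff v i (mulmxr (row_mx 1%:M 0)) by exact: is_diff_affine.
have dj v w : is_diff w (j v) (mulmxr (row_mx 0 1%:M)) by exact: is_diff_affine.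
have ci v : {for v, continuous i}.
  by case: (di v) => d _; exact: differentiable_continuous.
pose N := i @^-1` Q.
have oN : open N by apply: open_comp => // v _; exact: ci.
exists N; split=> //; first by rewrite /N /preimage /= iE.
move=> k.
apply: (@eq_Ck_on _ _ _ _ _ ((fun u => differential conj_chart u (row_mx 0 Y)) \o i)) => //.
  move=> v Nv /=; rewrite -mread_conj_differential.
  have Qv : Q (row_mx v e) by rewrite -iE.
  have [dje _] := dj v e.
  have dK : differentiable conj_chart (j v e).
    by rewrite jE; exact: smooth_on_differential Qv.
  have -> : c1 \o (fun w => (cinv c1 v * cinv c1 w * (cinv c1 v)^-1)%g) = conj_chart \o j v.
    by apply/funext => w /=; rewrite jE /conj_chart row_mxKl row_mxKr.
  rewrite (differential_comp _ dje dK) (differential_is_diff _ (dj v e)) jE iE /=.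
  by rewrite mul_mx_row mulmx0 mulmx1.
by apply: Ck_on_affine_comp (smooth_on_derive _ oQ sK k).
Qed.

Lemma Ad_chart_differentiable Y : differentiable (fun v => AdL A (cinv c1 v) Y) e.
Proof. by have [N [oN Ne sN]] := Ad_chart_smooth Y; exact: smooth_on_differential Ne. Qed.

Lemma bracketE X Y :
  bracket A X Y = differential (fun v => AdL A (cinv c1 v) Y) e X.
Proof. by rewrite bracket.unlock differential.unlock AdL.unlock. Qed.

Lemma bracketPl a X X' Y :
  bracket A (a *: X + X') Y = a *: bracket A X Y + bracket A X' Y.
Proof. by rewrite !bracketE linearP. Qed.

Lemma bracket0l Y : bracket A 0 Y = 0.
Proof. by rewrite bracketE linear0. Qed.

Lemma bracketZl a X Y : bracket A (a *: X) Y = a *: bracket A X Y.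
Proof. by have := bracketPl a X 0 Y; rewrite bracket0l !addr0. Qed.

Lemma bracket_is_linear X : linear (bracket A X).
Proof.
move=> a Y Z; rewrite !bracketE.
have -> : (fun v => AdL A (cinv c1 v) (a *: Y + Z)) =
    (fun v => (cst a v) *: AdL A (cinv c1 v) Y + AdL A (cinv c1 v) Z).
  by apply/funext => v; rewrite linearP.
have [d dE] := differentialZ X (differentiable_cst a e) (Ad_chart_differentiable Y).
rewrite differentialD //; last exact: Ad_chart_differentiable.
by rewrite dE differential_cst scale0r addr0.
Qed.

Lemma differential_Ad (V : normedModType R) (f : V -> G) x v Y :
  f x = 1%g -> {for x, continuous f} -> differentiable (c1 \o f) x ->
  differentiable (fun y => AdL A (f y) Y) x /\
  differential (fun y => AdL A (f y) Y) x v = bracket A (differential (c1 \o f) x v) Y.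
Proof.
move=> fx1 cf dcf.
have E : \forall y \near x, ((fun v => AdL A (cinv c1 v) Y) \o (c1 \o f)) y = AdL A (f y) Y.
  have : \forall y \near x, cdom c1 (f y).
    by apply: cf; rewrite fx1; apply: open_nbhs_nbhs; split=> //; exact: cdom_open.
  by apply: filterS => y fy /=; rewrite cmapK.
have dAd : differentiable (fun v => AdL A (cinv c1 v) Y) ((c1 \o f) x).
  by rewrite /= fx1; exact: Ad_chart_differentiable.
have dc := differentiable_comp dcf dAd.
split; first exact: near_eq_differentiable E dc.
by rewrite -(near_eq_differential _ E dc) (differential_comp _ dcf dAd) /= fx1 bracketE.
Qed.

(** Differentiate the identity [Ad (g a g^-1) (Ad g Y) = Ad g (Ad a Y)] in [a] at 1. *)
Lemma bracket_Ad g X Y : bracket A (AdL A g X) (AdL A g Y) = AdL A g (bracket A X Y).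
Proof.
pose f v := (g * cinv c1 v * g^-1)%g.
have fe : f e = 1%g by rewrite /f cinv1 mulg1 mulgV.
have cf : {for e, continuous f}.
  apply: (@continuous_comp _ _ _ (cinv c1) (fun a => (g * a * g^-1)%g)).
    by apply: cinv_cont; exists 1%g.
  exact: smooth_continuous (smooth_conj hG g) _.
have dcf : differentiable (c1 \o f) e.
  apply: (@mread_differentiable _ _ _ _ _ _ _ _ 1%g 1%g 1%g (smooth_conj hG g)) => //.
  by rewrite mulg1 mulgV.
rewrite -[AdL A g X]mread_conj_differential.
have [_ <-] := differential_Ad X (AdL A g Y) fe cf dcf.
have -> : (fun y => AdL A (f y) (AdL A g Y)) =
    AdL A g \o (fun v => AdL A (cinv c1 v) Y).
  apply/funext => v /=; rewrite -!(AdM hG); congr (AdL A _ _).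
  by rewrite /f -mulgA mulVg mulg1.
have cAd : continuous (AdL A g) by exact: linear_rV_continuous.
rewrite differential_comp; [|exact: Ad_chart_differentiable|exact: linear_rV_differentiable].
by rewrite differential_linear // bracketE.
Qed.

(** Differentiate [Ad a [Y, Z] = [Ad a Y, Ad a Z]] in [a] at 1 along [X]. The right-hand side is
    written as the sum of the vectors [F i], that is [[Ad a Y, e_i]], with the coordinates of
    [Ad a Z] as coefficients. *)
Lemma bracket_Leibniz X Y Z : bracket A X (bracket A Y Z) =
  bracket A (bracket A X Y) Z + bracket A Y (bracket A X Z).
Proof.
pose a Y v := AdL A (cinv c1 v) Y.
have da W : differentiable (a W) e by exact: Ad_chart_differentiable.
have ae W : a W e = W by rewrite /a cinv1 Ad1.
have aX W : differential (a W) e X = bracket A X W by rewrite bracketE.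
pose F i := differential (a (delta_mx 0 i)) e \o a Y.
have cF (i : 'I_n) : continuous (differential (a (delta_mx 0 i)) e).
  exact: linear_rV_continuous.
have dF i : differentiable (F i) e.
  by apply: differentiable_comp => //; exact: linear_rV_differentiable.
have FX i : differential (F i) e X = bracket A (bracket A X Y) (delta_mx 0 i).
  rewrite differential_comp //; last exact: linear_rV_differentiable.
  by rewrite aX [RHS]bracketE; apply: differential_linear; exact: cF.
have sumb (U W : 'rV[R]_n) : \sum_i W 0 i *: bracket A U (delta_mx 0 i) = bracket A U W.
  have L := bracket_is_linear U.
  pose bU : {linear 'rV[R]_n -> 'rV[R]_n} :=
    HB.pack (bracket A U) (GRing.isLinear.Build _ _ _ _ _ L).
  have -> : bracket A U W = bU W by [].
  by rewrite [in RHS](row_sum_delta W) linear_sum; apply: eq_bigr => i _; rewrite linearZ.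
have E : a (bracket A Y Z) = fun v => \sum_i a Z v 0 i *: F i v.
  apply/funext => v; rewrite /a -bracket_Ad -sumb; apply: eq_bigr => i _.
  by rewrite bracketE.
rewrite -[LHS]aX E (differential_lincomb X dF (da Z)).2 aX ae.
congr (_ + _).
  by rewrite -[RHS]sumb; apply: eq_bigr => i _; rewrite FX.
by rewrite -[RHS]sumb; apply: eq_bigr => i _; congr (_ *: _); rewrite /F /= ae bracketE.
Qed.

End Bracket.

(** * Graded semisimple algebras *)

Section GradedAlgebra.
Context {R : realType} {n : nat} {k : nat}.
Variables (br : 'rV[R]_n -> 'rV[R]_n -> 'rV[R]_n) (gr : int -> {vspace 'rV[R]_n}).
Hypotheses (brPl : forall a X X' Y, br (a *: X + X') Y = a *: br X Y + br X' Y)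
  (brPr : forall X, linear (br X))
  (Leibniz : forall X Y Z, br X (br Y Z) = br (br X Y) Z + br Y (br X Z))
  (nondeg : forall X,
     (forall Y, \tr (lin1_mx (br X) *m lin1_mx (br Y)) = 0) -> X = 0)
  (hgr : lie_grading br k gr).

HB.instance Definition _ X := GRing.isLinear.Build R 'rV[R]_n 'rV[R]_n _ (br X) (brPr X).

Let brl Y := fun X => br X Y.

Let brl_is_linear Y : linear (brl Y).
Proof. by move=> a X X'; exact: brPl. Qed.

HB.instance Definition _ Y :=
  GRing.isLinear.Build R 'rV[R]_n 'rV[R]_n _ (brl Y) (brl_is_linear Y).

Let br_suml (I : finType) (P : pred I) (F : I -> 'rV[R]_n) Y :
  br (\sum_(i | P i) F i) Y = \sum_(i | P i) br (F i) Y.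
Proof. exact: (linear_sum (brl Y)). Qed.

Let brBl X X' Y : br (X - X') Y = br X Y - br X' Y.
Proof. exact: (linearB (brl Y)). Qed.

Let brDl X X' Y : br (X + X') Y = br X Y + br X' Y.
Proof. exact: (linearD (brl Y)). Qed.

Let br0l Y : br 0 Y = 0.
Proof. exact: (linear0 (brl Y)). Qed.

Let brZl a X Y : br (a *: X) Y = a *: br X Y.
Proof. by have := brPl a X 0 Y; rewrite br0l !addr0. Qed.

Let brDr X Y Z : br X (Y + Z) = br X Y + br X Z.
Proof. exact: linearD. Qed.

Let br_sumr (I : finType) (P : pred I) (F : I -> 'rV[R]_n) X :
  br X (\sum_(i | P i) F i) = \sum_(i | P i) br X (F i).
Proof. exact: linear_sum. Qed.

Local Notation ad X := (lin1_mx (br X)).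

Let adE X Y : Y *m ad X = br X Y.
Proof. by rewrite mul_rV_lin1. Qed.

Lemma eq_mul_rV m (M M' : 'M[R]_(n, m)) : (forall v : 'rV_n, v *m M = v *m M') -> M = M'.
Proof. by move=> E; apply/row_matrixP => i; rewrite !rowE. Qed.

Let ad_suml (I : finType) (F : I -> 'rV[R]_n) (c : I -> R) :
  ad (\sum_i c i *: F i) = \sum_i c i *: ad (F i).
Proof.
apply: eq_mul_rV => v; rewrite adE br_suml mulmx_sumr; apply: eq_bigr => i _.
by rewrite brZl -scalemxAr adE.
Qed.

(** Vectors are rows and matrices act on the right, whence the order of the factors in the
    commutator. *)
Lemma ad_br X Y : ad (br X Y) = ad Y *m ad X - ad X *m ad Y.
Proof.
apply: eq_mul_rV => Z; rewrite mulmxBr !mulmxA !adE Leibniz.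
by rewrite addrK.
Qed.

Lemma center_trivial X : (forall Y, br X Y = 0) -> X = 0.
Proof.
move=> brX0; apply: nondeg => Y; have -> : ad X = 0; last by rewrite mul0mx mxtrace0.
by apply: eq_mul_rV => v; rewrite adE brX0 mulmx0.
Qed.

(** The Leibniz rule makes [ad [X, X]] the commutator of [ad X] with itself, so [[X, X]] acts by
    zero; nondegeneracy then forces it to vanish. This is the source of antisymmetry. *)
Lemma brXX X : br X X = 0.
Proof.
apply: center_trivial => Z; rewrite -adE ad_br.
by rewrite subrr mulmx0.
Qed.

Lemma br_anti X Y : br X Y = - br Y X.
Proof.
have := brXX (X + Y); rewrite brDl !brDr !brXX add0r addr0 => /eqP.
by rewrite addr_eq0 => /eqP.
Qed.

(* The functional [Y |-> tr (D ad Y)] is represented by some [E] through the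
   Killing form; then [D - ad E] maps into the radical of the Killing form. *)
Lemma derivation_inner (D : 'M[R]_n) :
    (forall X Y, br X Y *m D = br (X *m D) Y + br X (Y *m D)) ->
  exists E, forall X, br E X = X *m D.
Proof.
move=> derD; pose e i : 'rV[R]_n := delta_mx 0 i.
pose K := \matrix_(i, j) \tr (ad (e i) *m ad (e j)).
have KE v j : (v *m K) 0 j = \tr (ad v *m ad (e j)).
  rewrite mxE {2}(row_sum_delta v) ad_suml mulmx_suml raddf_sum /=.
  by apply: eq_bigr => i _; rewrite mxE -scalemxAl mxtraceZ.
have trE M w : \tr (M *m ad w) = \sum_j w 0 j * \tr (M *m ad (e j)).
  rewrite {1}(row_sum_delta w) ad_suml mulmx_sumr raddf_sum /=.
  by apply: eq_bigr => j _; rewrite -scalemxAr mxtraceZ.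
have uK : K \in unitmx.
  rewrite -row_free_unit; apply: inj_row_free => v vK0; apply: nondeg => Y.
  by rewrite trE big1 // => j _; rewrite -KE vK0 mxE mulr0.
pose E := (\row_j \tr (D *m ad (e j))) *m invmx K; exists E.
have ED Y : \tr (ad E *m ad Y) = \tr (D *m ad Y).
  rewrite !trE; apply: eq_bigr => j _; rewrite -KE.
  by rewrite /E mulmxKV // mxE.
have [D' D'E] : exists D', D' = D - ad E by exists (D - ad E).
have D'0 Y : \tr (D' *m ad Y) = 0.
  by rewrite D'E mulmxBl raddfB /= ED subrr.
have derD' X Y : br X Y *m D' = br (X *m D') Y + br X (Y *m D').
  by rewrite D'E !mulmxBr !adE derD Leibniz brBl linearB opprD addrACA.
have adD' X : ad (X *m D') = ad X *m D' - D' *m ad X.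
  by apply: eq_mul_rV => Y; rewrite mulmxBr !mulmxA !adE derD' addrK.
move=> X; apply/eqP; rewrite -subr_eq0 -oppr_eq0 opprB -adE -mulmxBr -D'E; apply/eqP.
(* As [D'] is a derivation, [ad (X D')] is the commutator of [ad X] and [D']. By cyclicity of the
   trace its pairing with [ad Y] is the trace of [D'] times [ad [X, Y]], which is zero. *)
apply: nondeg => Y; rewrite adD' mulmxBl raddfB /=.
rewrite -[ad X *m D' *m _]mulmxA mxtrace_mulC -!mulmxA -raddfB -mulmxBr -ad_br.
exact: D'0.
Qed.

Let N := (2 * k).+1.
Let deg (j : 'I_N) : int := j%:Z - k%:Z.

Let deg_inj : injective deg.
Proof. by move=> i j; rewrite /deg => E; apply: val_inj => /=; lia. Qed.

Let deg_surj (i : int) : `|i| <= k%:Z -> exists j, deg j = i.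
Proof.
move=> ik; have jN : (absz (i + k%:Z)%R < N)%N by rewrite /N; lia.
by exists (Ordinal jN); rewrite /deg /=; lia.
Qed.

Let gr_out i X : k%:Z < `|i| -> X \in gr i -> X = 0.
Proof. by case: hgr => _ out _ _ _ /out ->; rewrite memv0 => /eqP. Qed.

Let gr_br i j X Y : X \in gr i -> Y \in gr j -> br X Y \in gr (i + j).
Proof. by case: hgr => _ _ _ _; exact. Qed.

Let defV : fullv = (\sum_(j < N) gr (deg j))%VS.
Proof. by case: hgr => _ _ _ ->. Qed.

Let pr (j : 'I_N) : 'End('rV[R]_n) := sumv_pi_for defV j.

(** The sum has at most one term, and none for [i] outside the range from [-k] to [k], so that
    components exist in every integer degree. *)
Definition hcomp (i : int) (X : 'rV[R]_n) : 'rV[R]_n := \sum_(j < N | deg j == i) pr j X.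

Let hcomp_is_linear i : linear (hcomp i).
Proof.
move=> a X Y; rewrite /hcomp scaler_sumr -big_split; apply: eq_bigr => j _.
by rewrite linearP.
Qed.

HB.instance Definition _ i :=
  GRing.isLinear.Build R 'rV[R]_n 'rV[R]_n _ (hcomp i) (hcomp_is_linear i).

Let hcomp_deg j X : hcomp (deg j) X = pr j X.
Proof. by rewrite /hcomp (big_pred1 j) // => l; rewrite (inj_eq deg_inj). Qed.

Lemma hcomp_mem i X : hcomp i X \in gr i.
Proof.
apply: rpred_sum => j /eqP <-; exact: memv_sum_pi.
Qed.

Let sum_hcomp X : X = \sum_j hcomp (deg j) X.
Proof.
rewrite -[LHS](sumv_pi_sum defV (memvf X)).
by apply: eq_bigr => j _; rewrite hcomp_deg.
Qed.

Lemma hcomp_gr i j X : X \in gr j -> hcomp i X = if i == j then X else 0.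
Proof.
move=> Xj; have [jk|kj] := leP `|j| k%:Z; last first.
  by rewrite (gr_out kj Xj) linear0 if_same.
have [l degl] := deg_surj jk.
have dir : directv (\sum_(j < N) gr (deg j)) by case: hgr.
have Xl : \sum_(m < N) (if m == l then X else 0) = X.
  by rewrite -big_mkcond big_pred1_eq.
have prX m : pr m X = if m == l then X else 0.
  have prX_mem m' : true -> pr m' X \in gr (deg m') by move=> _; exact: memv_sum_pi.
  have X_mem m' : true -> (if m' == l then X else 0) \in gr (deg m').
    by move=> _; case: eqP => [->|_]; [rewrite degl|exact: mem0v].
  have := directv_sum_unique dir _ _ prX_mem X_mem.
  by rewrite (sumv_pi_sum defV (memvf X)) Xl eqxx => /esym/forallP/(_ m)/eqP.
have [->|ij] := eqVneq i j; first by rewrite -degl hcomp_deg prX eqxx.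
by rewrite /hcomp big1 // => m /eqP mi; rewrite prX; case: eqP => // ml; move: ij;
  rewrite -mi ml degl eqxx.
Qed.

Lemma hcomp_eq0 X : (forall i, hcomp i X = 0) -> X = 0.
Proof. by move=> h0; rewrite (sum_hcomp X) big1. Qed.

Lemma gr_hcomp i X : (forall j, j != i -> hcomp j X = 0) -> X \in gr i.
Proof.
move=> h; have -> : X = hcomp i X; last exact: hcomp_mem.
apply/eqP; rewrite -subr_eq0; apply/eqP; apply: hcomp_eq0 => j.
rewrite linearB /= (hcomp_gr _ (hcomp_mem i X)).
by have [->|/h ->] := eqVneq j i; rewrite ?subrr ?subr0.
Qed.

Lemma filtrationP i X :
  X \in filtration k gr i <-> forall j, j < i -> hcomp j X = 0.
Proof.
split=> [/memv_sumP[vs vsg ->] j ji|h].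
  rewrite linear_sum big1 // => l il /=.
  rewrite (hcomp_gr _ (vsg l il)); case: eqP => // E.
  by move: ji; rewrite E ltNge il.
rewrite (sum_hcomp X) (bigID (fun l => i <= deg l)) /= [X in _ + X]big1 ?addr0.
  by apply: memv_sumr => l _; exact: hcomp_mem.
by move=> l; rewrite -ltNge => /h.
Qed.

Local Notation F := (filtration k gr).

Lemma gr_filtration i j X : i <= j -> X \in gr j -> X \in F i.
Proof.
move=> ij Xj; apply/filtrationP => l li; rewrite (hcomp_gr _ Xj).
by case: eqP => // E; move: li; rewrite E ltNge ij.
Qed.

Lemma filtration_le i j X : i <= j -> X \in F j -> X \in F i.
Proof.
move=> ij /filtrationP h; apply/filtrationP => l li; apply: h.
exact: lt_le_trans ij.
Qed.

Lemma filtration_sub_hcomp i X : X \in F i -> X - hcomp i X \in F (i + 1).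
Proof.
move=> /filtrationP h; apply/filtrationP => l; rewrite ltzD1 le_eqVlt => /predU1P[->|li].
  by rewrite linearB /= (hcomp_gr _ (hcomp_mem i X)) eqxx subrr.
rewrite linearB /= (h _ li) (hcomp_gr _ (hcomp_mem i X)) (lt_eqF li).
by rewrite subrr.
Qed.

Lemma gr_cap_filtration i j X : i < j -> X \in gr i -> X \in F j -> X = 0.
Proof.
by move=> ij Xi /filtrationP/(_ _ ij); rewrite (hcomp_gr _ Xi) eqxx.
Qed.

Lemma filtration_out i X : k%:Z < i -> X \in F i -> X = 0.
Proof.
move=> ki /filtrationP h; apply: hcomp_eq0 => j.
have [/h //|ij] := ltP j i.
by apply: (gr_out _ (hcomp_mem j X)); lia.
Qed.

Lemma filtration_br i j X Y : X \in F i -> Y \in F j -> br X Y \in F (i + j).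
Proof.
move=> /filtrationP Xi /filtrationP Yj; apply/filtrationP => l lij.
rewrite (sum_hcomp X) br_suml linear_sum big1 // => a _ /=.
rewrite (sum_hcomp Y) linear_sum linear_sum big1 // => b _ /=.
have [ai|ia] := ltP (deg a) i; first by rewrite Xi // br0l linear0.
have [bj|jb] := ltP (deg b) j; first by rewrite Yj // !linear0.
rewrite (hcomp_gr _ (gr_br (hcomp_mem _ X) (hcomp_mem _ Y))).
by case: eqP => // E; move: lij; rewrite E; lia.
Qed.

Lemma iter_br_filtration Z X i m : Z \in F 1 -> X \in F i ->
  iter m (br Z) X \in F (i + m%:Z).
Proof.
move=> Z1 Xi; elim: m => [|m IH]; first by rewrite addr0.
rewrite intS addrCA.
exact: filtration_br.
Qed.

Let D (X : 'rV[R]_n) : 'rV[R]_n := \sum_j (deg j)%:~R *: hcomp (deg j) X.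

Let D_is_linear : linear D.
Proof.
move=> a X Y; rewrite /D scaler_sumr -big_split; apply: eq_bigr => j _.
by rewrite linearP scalerDr /= !scalerA mulrC.
Qed.

HB.instance Definition _ := GRing.isLinear.Build R 'rV[R]_n 'rV[R]_n _ D D_is_linear.

Let D_gr i X : X \in gr i -> D X = i%:~R *: X.
Proof.
move=> Xi; rewrite [in RHS](sum_hcomp X) scaler_sumr; apply: eq_bigr => j _.
by rewrite (hcomp_gr _ Xi); case: eqP => [->|]; rewrite ?scaler0.
Qed.

Let D_derivation X Y : D (br X Y) = br (D X) Y + br X (D Y).
Proof.
have lX (f : {linear 'rV[R]_n -> 'rV[R]_n}) U : f U = \sum_j f (hcomp (deg j) U).
  by rewrite -linear_sum -sum_hcomp.
have lXl U V : br U V = \sum_j br (hcomp (deg j) U) V.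
  by rewrite -br_suml -sum_hcomp.
have E1 : br (D X) Y = \sum_j br (D (hcomp (deg j) X)) Y := lX (brl Y \o D) X.
rewrite E1 (lXl X Y) linear_sum (lXl X (D Y)) -big_split.
apply: eq_bigr => a _ /=; set Xa := hcomp _ X.
have E2 : br Xa (D Y) = \sum_j br Xa (D (hcomp (deg j) Y)) := lX (br Xa \o D) Y.
rewrite E2 (lX (br Xa) Y) linear_sum (lX (br (D Xa)) Y) -big_split.
apply: eq_bigr => b _ /=; rewrite {E2}/Xa.
have [Xa Yb] := (hcomp_mem (deg a) X, hcomp_mem (deg b) Y).
rewrite [LHS](D_gr (gr_br Xa Yb)) (D_gr Xa) (D_gr Yb) linearZ brZl /=.
by rewrite intrD scalerDl addrC.
Qed.

(** [E] represents the derivation acting by [i] on [gr i]. For the converse direction, the degree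
    [j] part of the eigenvalue equation reads [(j - i) X_j = 0]. The equivalence makes an
    automorphism that fixes [E] preserve the grading. *)
Lemma grading_element : exists E, forall i X, X \in gr i <-> br E X = i%:~R *: X.
Proof.
have [|E EP] := derivation_inner (D := lin1_mx D).
  by move=> X Y; rewrite !mul_rV_lin1; exact: D_derivation.
exists E => i X; rewrite EP mul_rV_lin1; split; first exact: D_gr.
move=> DX; apply: gr_hcomp => j ji.
have := congr1 (hcomp j) DX; rewrite linearZ /= /D linear_sum.
have [jk|kj] := leP `|j| k%:Z; last by move=> _; exact: gr_out kj (hcomp_mem j X).
have [l degl] := deg_surj jk.
rewrite (bigD1 l) //= big1 => [|m ml]; last first.
  rewrite linearZ /= (hcomp_gr _ (hcomp_mem _ X)) -degl (inj_eq deg_inj) eq_sym.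
  by rewrite (negPf ml) scaler0.
rewrite addr0 linearZ /= (hcomp_gr _ (hcomp_mem _ X)) degl eqxx => /eqP.
rewrite -subr_eq0 -scalerBl -intrB scaler_eq0 intr_eq0 subr_eq0 (negPf ji) /=.
by move=> /eqP.
Qed.

(** * Images of the grading element under filtered automorphisms and exponentials *)

Section GradingElement.
Variable E : 'rV[R]_n.
Hypothesis EP : forall i X, X \in gr i <-> br E X = i%:~R *: X.

Lemma grading_element_gr0 : E \in gr 0.
Proof. by apply/EP; rewrite brXX scale0r. Qed.

Let EF0 : E \in F 0.
Proof. exact: gr_filtration grading_element_gr0. Qed.

Lemma grading_element_filtration i X : X \in F i -> br E X - i%:~R *: X \in F (i + 1).
Proof.
move=> Xi; have X'F := filtration_sub_hcomp Xi; set X' := X - hcomp i X in X'F.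
have -> : X = hcomp i X + X' by rewrite addrC subrK.
rewrite brDr (EP i _).1 ?hcomp_mem // scalerDr opprD addrACA subrr add0r.
apply: memvB; last exact: memvZ.
by rewrite -[i + 1]add0r; exact: filtration_br.
Qed.

(** Both [a E] and [E] act by [i] on the quotient of [F i] by [F (i + 1)]; for [a E] this is seen by
    writing a vector as [a (a' Y)]. So the degree 0 part of the difference [W] maps [gr i] into both
    [gr i] and [F (i + 1)], hence to zero; being central, it vanishes. *)
Lemma automorphism_grading_element (a a' : {linear 'rV[R]_n -> 'rV[R]_n}) :
    cancel a' a -> (forall X Y, a (br X Y) = br (a X) (a Y)) ->
    (forall i X, X \in F i -> a X \in F i) ->
    (forall i X, X \in F i -> a' X \in F i) ->
  a E - E \in F 1.
Proof.
move=> aK abr aF a'F; set W := a E - E.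
have WF : W \in F 0 by apply: memvB => //; exact: aF.
have W'F := filtration_sub_hcomp WF; rewrite add0r in W'F.
suff W0 : hcomp 0 W = 0 by move: W'F; rewrite W0 subr0.
apply: center_trivial => Y; rewrite (sum_hcomp Y) br_sumr big1 // => j _.
set i := deg j; set Yi := hcomp i Y.
have Yg : Yi \in gr i by exact: hcomp_mem.
have YF : Yi \in F i by exact: gr_filtration Yg.
apply: (@gr_cap_filtration i (i + 1)); first by rewrite ltrDl.
  by rewrite -[i]add0r; apply: gr_br => //; exact: hcomp_mem.
have -> : br (hcomp 0 W) Yi = br W Yi - br (W - hcomp 0 W) Yi.
  by rewrite -brBl subKr.
apply: memvB; last by rewrite [i + 1]addrC; exact: filtration_br.
have -> : br W Yi = a (br E (a' Yi) - i%:~R *: a' Yi).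
  by rewrite linearB linearZ /= abr aK /W brBl (EP i Yi).1.
by apply: aF; apply: grading_element_filtration; exact: a'F.
Qed.

(* The degree [d + 1] part of [exp (ad Z) E - E] is [- (d + 1) Z_(d + 1)] up to
   terms in the components of [Z] of lower degree, so that these components can
   be determined one after the other. *)
Lemma exp_ad_grading_element W : W \in F 1 ->
  exists2 Z, Z \in F 1 &
    \sum_(m < k.+2) (m`!%:R)^-1 *: iter m (br Z) E = E + W.
Proof.
(* [S Z] is all of [exp (ad Z) E], since each bracket with [Z] raises the filtration degree and
   iterates beyond the [k]-th vanish. For [d = k] the error in [main] lies in [F (k + 1)], which is
   zero. *)
move=> W1; pose S Z := \sum_(m < k.+2) (m`!%:R)^-1 *: iter m (br Z) E.
suff main d : exists2 Z, Z \in F 1 & S Z - (E + W) \in F (d%:Z + 1).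
  have [Z Z1 SZ] := main k; exists Z => //.
  apply/eqP; rewrite -subr_eq0; apply/eqP; apply: filtration_out SZ.
  by rewrite ltrDl.
elim: d => [|d [Z Z1 SZ]].
  exists 0; first exact: mem0v.
  rewrite /S big_ord_recl /= big1 => [|i _]; last by rewrite br0l scaler0.
  rewrite fact0 invr1 scale1r addr0 opprD addrA subrr add0r.
  by rewrite memvN.
set V := S Z - (E + W) in SZ.
pose c : R := (d%:Z + 1)%:~R.
have c0 : c != 0 by rewrite intr_eq0; lia.
(* Adding [U] to [Z] changes [S] by [[U, E] = - (d + 1) U] modulo higher degree, so this [U] cancels
   the component of degree [d + 1] of the error [V]. *)
pose U := c^-1 *: hcomp (d%:Z + 1) V.
have Ug : U \in gr (d%:Z + 1) by apply: memvZ; exact: hcomp_mem.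
have UF : U \in F (d%:Z + 1) by exact: gr_filtration Ug.
have Z'1 : Z + U \in F 1.
  by apply: memvD => //; apply: filtration_le UF; rewrite lerDr.
exists (Z + U) => //.
(* One bracket with [U] gains degree [d + 1] and each further bracket at least 1, so only the linear
   term of [S] is affected in degree [d + 1]. *)
have T m : iter m.+1 (br (Z + U)) E - iter m.+1 (br Z) E \in F (d%:Z + 1 + m%:Z).
  elim: m => [|m IH].
    by rewrite /= brDl addrAC subrr add0r; exact: filtration_br.
  set a' := iter m.+1 (br (Z + U)) E in IH *; set a := iter m.+1 (br Z) E in IH *.
  have -> : iter m.+2 (br (Z + U)) E - iter m.+2 (br Z) E =
      br (Z + U) (a' - a) + br U a.
    by rewrite !iterS -/a -/a' linearB /= [br (Z + U) a]brDl opprD addrA subrK.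
  apply: memvD.
    have -> : d%:Z + 1 + m.+1%:Z = 1 + (d%:Z + 1 + m%:Z) by rewrite intS addrCA.
    exact: filtration_br.
  rewrite -[m.+1%:Z]add0r.
  by apply: filtration_br => //; exact: iter_br_filtration.
have SU : S (Z + U) - S Z + hcomp (d%:Z + 1) V \in F (d.+1%:Z + 1).
  rewrite /S -sumrB big_ord_recl big_ord_recl /= subrr add0r.
  rewrite /bump /= !factS fact0 !muln1 invr1 !scale1r brDl.
  rewrite [_ + br U E]addrC addrK br_anti ((EP _ _).1 Ug) /U scalerA mulfV // scale1r.
  rewrite addrAC addNr add0r; apply: rpred_sum => i _.
  rewrite -scalerBr; apply: memvZ; apply: filtration_le (T i.+1).
  by clear; lia.
have VF := filtration_sub_hcomp SZ.
have -> : S (Z + U) - (E + W) =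
    (S (Z + U) - S Z + hcomp (d%:Z + 1) V) + (V - hcomp (d%:Z + 1) V).
  by rewrite [V - _]addrC addrA addrK /V addrA subrK.
apply: memvD => //; apply: filtration_le VF.
by rewrite intS [1 + _]addrC.
Qed.

End GradingElement.

End GradedAlgebra.

(** * The exponential map *)

Section Exponential.
Context {R : realType} {G : groupWithTopologyType} {n : nat} {A : manifold R G n}.
Variable expG : 'rV[R]_n -> G.
Hypotheses (hG : lie_group A) (hexp : exponential_map A expG).

Local Notation c1 := (chart_at A 1%g).

Lemma expD X (s t : R) : expG ((s + t) *: X) = (expG (s *: X) * expG (t *: X))%g.
Proof. by case: (hexp X). Qed.

Lemma exp0 : expG 0 = 1%g.
Proof.
have := expD 0 0 0; rewrite !scaler0 => E.
by apply: (mulgI (expG 0)); rewrite -E mulg1.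
Qed.

Lemma expN X : expG (- X) = (expG X)^-1%g.
Proof.
apply: (mulgI (expG X)); rewrite mulgV.
by have := expD X 1 (-1); rewrite subrr scale0r exp0 scale1r scaleN1r.
Qed.

Lemma exp_curve_continuous X : continuous (fun t : R => expG (t *: X)).
Proof. by case: (hexp X) => -[]. Qed.

Lemma exp_curve_differentiable X :
  differentiable (c1 \o (fun t : R => expG (t *: X))) 0.
Proof.
case: (hexp X) => -[_ /(_ 0) sm] _ _; rewrite scale0r exp0 in sm.
apply: smooth_on_differential sm _.
by rewrite /preimage /= scale0r exp0; exact: chart_at_mem.
Qed.

Lemma exp_curve_differential X (s : R) :
  differential (c1 \o (fun t : R => expG (t *: X))) 0 s = s *: X.
Proof.
have dc := exp_curve_differentiable X.
case: (hexp X) => _ _; rewrite /velocity scale0r exp0 (derive_differential _ dc) => v.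
have L1 (L : {linear R -> 'rV[R]_n}) : L s = s *: L 1.
  by rewrite -linearZZ; congr (L _); rewrite /GRing.scale /= mulr1.
by apply: etrans (L1 _) _; congr (s *: _); exact: v.
Qed.

(** Factoring [exp (u X)] as [exp (t X) exp ((u - t) X)] moves the derivative at [t] to the
    identity, where it is the bracket. *)
Lemma Ad_exp_curve X Y (t s : R) :
  differentiable (fun u : R => AdL A (expG (u *: X)) Y) t /\
  differential (fun u : R => AdL A (expG (u *: X)) Y) t s =
    s *: AdL A (expG (t *: X)) (bracket A X Y).
Proof.
pose f (u : R) := expG ((u - t) *: X).
have dt : is_diff t (fun u : R => u - t) id.
  by apply: is_diff_eq (is_diffB (is_diff_id t) (is_diff_cst t t)) _; rewrite subr0.
have [dtd _] := dt.
have ft : f t = 1%g by rewrite /f subrr scale0r exp0.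
have cf : {for t, continuous f}.
  apply: (@continuous_comp _ _ _ (fun u : R => u - t) (fun u : R => expG (u *: X))).
    exact: differentiable_continuous.
  exact: exp_curve_continuous.
have dc0 : differentiable (c1 \o (fun u : R => expG (u *: X))) (t - t).
  by rewrite subrr; exact: exp_curve_differentiable.
have dcf : differentiable (c1 \o f) t.
  exact: (@differentiable_comp R R R _ (fun u : R => u - t) _ t dtd dc0).
have dcfE : differential (c1 \o f) t s = s *: X.
  have := differential_comp s dtd dc0.
  by rewrite (differential_is_diff s dt) subrr exp_curve_differential.
have [dAd dAdE] := differential_Ad hG s Y ft cf dcf.
have -> : (fun u : R => AdL A (expG (u *: X)) Y) =
    AdL A (expG (t *: X)) \o (fun u => AdL A (f u) Y).
  apply/funext => u /=; rewrite -(AdM hG) /f -expD.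
  by rewrite addrC subrK.
split; first by apply: differentiable_comp => //; exact: linear_rV_differentiable.
rewrite differential_comp //; last exact: linear_rV_differentiable.
rewrite differential_linear; last exact: linear_rV_continuous.
rewrite dAdE dcfE -linearZ; congr (AdL _ _ _).
by rewrite bracketZl.
Qed.

Lemma differential_expn_fact m (t s : R) :
  differentiable (fun u : R => u ^+ m / m`!%:R) t /\
  differential (fun u : R => u ^+ m / m`!%:R) t s =
    s * (if m is m'.+1 then t ^+ m' / m'`!%:R else 0).
Proof.
have df0 (j : nat) : (j`!%:R : R) != 0 by rewrite pnatr_eq0 -lt0n fact_gt0.
have dX : differentiable (fun u : R => u ^+ m) t.
  by apply/derivable1_diffP; exact: exprn_derivable.
have -> : (fun u : R => u ^+ m / m`!%:R) = (m`!%:R)^-1 *: (fun u : R => u ^+ m).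
  by apply/funext => u; rewrite /= [LHS]mulrC.
split; first exact: differentiableZ.
rewrite differential.unlock diffZ //= -deriveE // exp_derive.
case: m dX => [|m] dX; first by rewrite mulr0 /GRing.scale /= !mul0r mulr0.
rewrite /GRing.scale /= factS natrM invfM.
have m0 : (m.+1%:R : R) != 0 by rewrite pnatr_eq0.
by move: (df0 m) m0; move: (m.+1%:R) (m`!%:R) => x z z0 x0; field; rewrite x0 z0.
Qed.

Lemma differential0_constant (f : R -> 'rV[R]_n) (a b : R) :
  (forall t, differentiable f t) -> (forall t s, differential f t s = 0) -> f b = f a.
Proof.
move=> df df0; apply/rowP => j; apply/eqP; rewrite -subr_eq0; apply/eqP.
have dfj (t : R) : differentiable (fun u => f u 0 j : R) t.
  exact: (differentiable_comp (df t) (differentiable_coord _ _ _)).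
have [t _ ->] := mean_value (a := a) (b := b) (fun t _ => dfj (a + t *: (b - a))).
by rewrite -differential_rV // df0 mxE.
Qed.

(* [t |-> Ad (exp (- t Z)) (exp (t ad Z) Y)] has derivative zero. *)
Lemma Ad_exp_nilpotent N Z Y : iter N.+1 (bracket A Z) Y = 0 ->
  AdL A (expG Z) Y = \sum_(m < N.+1) (m`!%:R)^-1 *: iter m (bracket A Z) Y.
Proof.
move=> ZN0; pose a m := iter m (bracket A Z) Y.
pose p m (t : R) : R := t ^+ m / m`!%:R.
pose dp m (t : R) : R := if m is m'.+1 then p m' t else 0.
pose h (t : R) := \sum_(m < N.+1) p m t *: AdL A (expG (t *: - Z)) (a m).
have dterm m (t s : R) : differentiable (fun t : R => p m t *: AdL A (expG (t *: - Z)) (a m)) t /\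
    differential (fun t : R => p m t *: AdL A (expG (t *: - Z)) (a m)) t s =
    s *: (dp m t *: AdL A (expG (t *: - Z)) (a m) -
          dp m.+1 t *: AdL A (expG (t *: - Z)) (a m.+1)).
  have [dpm dpE] := differential_expn_fact m t s.
  have [dA dAE] := Ad_exp_curve (- Z) (a m) t s.
  have [d dE] := differentialZ s dpm dA; split; first exact: d.
  rewrite [LHS]dE dAE dpE -/(dp m t).
  have -> : bracket A (- Z) (a m) = - a m.+1.
    by rewrite -scaleN1r bracketZl scaleN1r.
  rewrite linearN !scalerN scalerBr !scalerA addrC; congr (_ - _).
  by rewrite mulrC.
have [dh dh0] : (forall t, differentiable h t) /\ forall t s, differential h t s = 0.
  have H (t s : R) := differential_sum (index_enum 'I_N.+1) s (fun m : 'I_N.+1 => (dterm m t 0).1).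
  split=> [t|t s]; first exact: (H t 0).1.
  rewrite [LHS](H t s).2.
  under eq_bigr => m _ do rewrite (dterm m t s).2.
  rewrite -scaler_sumr.
  (* The derivative telescopes: the lower end vanishes because [dp 0] is 0, the upper end because
     [a N.+1] is 0. *)
  pose g m := dp m t *: AdL A (expG (t *: - Z)) (a m).
  have -> : \sum_(m < N.+1) (g m - g m.+1) = - \sum_(m < N.+1) (g m.+1 - g m).
    by rewrite -sumrN; apply: eq_bigr => m _; rewrite opprB.
  rewrite -(big_mkord xpredT (fun m => g m.+1 - g m)) telescope_sumr //.
  have aN : a N.+1 = 0 by [].
  by rewrite /g aN linear0 scaler0 scale0r subrr oppr0 scaler0.
have h0 : h 0 = Y.
  rewrite /h scale0r exp0 big_ord_recl big1 => [|i _].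
    by rewrite /p expr0 fact0 divr1 scale1r (Ad1 (A := A)) addr0.
  by rewrite /p /= expr0n /= mul0r scale0r.
rewrite -[in LHS]h0 -(differential0_constant 0 1 dh dh0) /h scale1r linear_sum.
by apply: eq_bigr => m _; rewrite linearZ /= expN (AdVK hG) /p expr1n mul1r.
Qed.

End Exponential.

(** * Coset spaces *)

Section CosetSpace.
Context {G : groupWithTopologyType} {P : set G}.
Hypothesis sP : subgroup P.

Local Notation pi := (coset_proj P).

Lemma coset_projP a b : pi a = pi b <-> P (a^-1 * b)%g.
Proof.
have [P1 PM PV] := sP.
have E : pi a = pi b <-> lcoset P a = lcoset P b.
  split=> [ab|ab].
    apply/asboolP; exact: (introT (generic_quotient.eqmodP (lcoset_equiv P) a b) ab).
  by apply: (elimT (generic_quotient.eqmodP (lcoset_equiv P) a b)); exact/asboolP.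
apply: iff_trans E _; split=> [ab|Pab].
  have [c Pc <-] : lcoset P a b by rewrite ab; exists 1%g => //; rewrite mulg1.
  by rewrite mulgA mulVg mul1g.
apply/seteqP; split=> _ [c Pc <-].
  exists ((a^-1 * b)^-1 * c)%g; first by apply: PM => //; exact: PV.
  by rewrite invgM invgK !mulgA mulgV mul1g.
exists (a^-1 * b * c)%g; first exact: PM.
by rewrite !mulgA mulgV mul1g.
Qed.

Lemma coset_reprK (x : coset_space P) : pi (repr (x : {eq_quot (lcoset_equiv P)}%qT)) = x.
Proof. exact: reprK. Qed.

Lemma coset_projM a b : P b -> pi (a * b)%g = pi a.
Proof.
have [_ _ PV] := sP => Pb; apply/coset_projP; rewrite invgM -mulgA mulVg mulg1.
exact: PV.
Qed.

Lemma left_translationE g a : left_translation P g (pi a) = pi (g * a)%g.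
Proof.
rewrite /left_translation; set b := repr _.
have /coset_projP : pi b = pi a by exact: coset_reprK.
by move=> Pba; apply/coset_projP; rewrite invgM -!mulgA mulKg.
Qed.

Lemma left_translation_comp g h :
  left_translation P g \o left_translation P h = left_translation P (g * h)%g.
Proof.
apply/funext => x; rewrite -[x]coset_reprK /=.
by rewrite !left_translationE mulgA.
Qed.

Lemma left_translation1 : left_translation P 1%g = id.
Proof.
by apply/funext => x; rewrite -[x in LHS]coset_reprK left_translationE mul1g coset_reprK.
Qed.

Lemma coset_continuous (T : topologicalType) (f : coset_space P -> T) :
  continuous (f \o pi) -> continuous f.
Proof. by move=> cf; apply/quotient_continuous. Qed.

End CosetSpace.

Section HomogeneousSpace.
Context {R : realType} {G : groupWithTopologyType} {n m : nat} {A : manifold R G n}.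
Context {P : set G} {B : manifold R (coset_space P) m}.
Variable expG : 'rV[R]_n -> G.
Hypotheses (hG : lie_group A) (hexp : exponential_map A expG) (sP : subgroup P)
  (hB : submersion A B (coset_proj P)).

Local Notation pi := (coset_proj P).
Local Notation c1 := (chart_at A 1%g).

Lemma smooth_coset_proj : smooth A B pi.
Proof. by case: hB. Qed.

(** Continuity is the universal property of the quotient topology; smoothness near [x] is
    [smooth_on_descent] for the projection read in charts around a point [a] over [x]. *)
Lemma smooth_coset_descent (T : topologicalType) l (D : manifold R T l)
  (f : coset_space P -> T) : smooth A D (f \o pi) -> smooth B D f.
Proof.
move=> sf; have cf : continuous f by apply: coset_continuous; exact: smooth_continuous sf.
apply: smooth_local => // x; have [a ax] : exists a, pi a = x.
  by exists (repr (x : {eq_quot (lcoset_equiv P)}%qT)); exact: coset_reprK.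
exists x, (f x); split; [exact: chart_at_mem|exact: chart_at_mem|].
have spi := smooth_coset_proj; have cpi := smooth_continuous spi.
have cfpi := smooth_continuous sf.
pose W := pi @^-1` cdom (chart_at B x) `&` (f \o pi) @^-1` cdom (chart_at D (f x)).
have oW : open W.
  by apply: openI; apply: open_comp => [z _|];
    [exact: cpi|exact: cdom_open|exact: cfpi|exact: cdom_open].
have oU := chart_image_open (c := chart_at A a) oW.
set U := (_ @` _) in oU.
have ax' : cdom (chart_at B x) (pi a) by rewrite ax; exact: chart_at_mem.
have Ua : U (chart_at A a a).
  exists a => //; split; first exact: chart_at_mem.
  by split=> //; rewrite /preimage /= ax; exact: chart_at_mem.
have spiU : smooth_on U (mread A B a x pi).
  move=> k; apply: Ck_on_sub (smooth_mread a x spi k) => _ [z [az [xz _]] <-].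
  by exists z.
have surj w : exists v, differential (mread A B a x pi) (chart_at A a a) v = w.
  have [_ /(_ a w)[v vw]] := hB; exists v.
  by rewrite -vw -ax differential.unlock.
have [V [oV Vx VP]] := smooth_on_descent l oU Ua spiU surj.
exists V; split=> //.
  by move: Vx; rewrite /mread /= cmapK; [rewrite ax|exact: chart_at_mem].
apply: VP => k.
apply: (@eq_Ck_on _ _ _ _ _ (mread A D a (f x) (f \o pi))) => //.
  by move=> _ [z [az [xz fxz]] <-]; rewrite /mread /= !cmapK.
by apply: Ck_on_sub (smooth_mread a (f x) sf k) => _ [z [az [xz fxz]] <-]; exists z.
Qed.

Lemma smooth_left_translation g : smooth B B (left_translation P g).
Proof.
apply: smooth_coset_descent.
have -> : left_translation P g \o pi = pi \o (fun a => (g * a)%g).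
  by apply/funext => a /=; rewrite left_translationE.
exact: smooth_comp (smooth_lmul hG g) smooth_coset_proj.
Qed.

(** Tangent maps at 1 are thereby computed along one-parameter subgroups, in any chart around [F 1];
    this turns statements about kernels into statements about curves. *)
Lemma exp_curve_image (T : topologicalType) l (D : manifold R T l) (F : G -> T) q X :
    smooth A D F -> cdom (chart_at D q) (F 1%g) ->
  differentiable (chart_at D q \o F \o (fun t : R => expG (t *: X))) 0 /\
  forall s : R, differential (chart_at D q \o F \o (fun t : R => expG (t *: X))) 0 s =
    s *: differential (mread A D 1%g q F) (c1 1%g) X.
Proof.
move=> sF qF1; pose g (t : R) := expG (t *: X).
have g0 : g 0 = 1%g by rewrite /g scale0r (exp0 hexp).
have dg := exp_curve_differentiable hexp X.
have E : \forall t \near (0 : R),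
    (mread A D 1%g q F \o (c1 \o g)) t = (chart_at D q \o F \o g) t.
  have : \forall t \near (0 : R), cdom c1 (g t).
    apply: (exp_curve_continuous hexp (X := X)); rewrite -/(g 0) g0.
    by apply: open_nbhs_nbhs; split; [exact: cdom_open|exact: chart_at_mem].
  by apply: filterS => t c1t; rewrite /mread /= cmapK.
have dF : differentiable (mread A D 1%g q F) ((c1 \o g) 0).
  by rewrite /= g0; apply: mread_differentiable => //; exact: chart_at_mem.
have dc := differentiable_comp dg dF.
split=> [|s]; first exact: near_eq_differentiable E dc.
rewrite -(near_eq_differential _ E dc) (differential_comp _ dg dF).
by rewrite (exp_curve_differential hexp) linearZ /= scale0r (exp0 hexp).
Qed.

Lemma expMn X j : expG (j%:R *: X) = (expG X ^+ j)%g.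
Proof.
elim: j => [|j IH]; first by rewrite scale0r (exp0 hexp) expg0.
by rewrite -natr1 (expD hexp) IH scale1r expgSr.
Qed.

(** For large [N] the element [exp (t X)] is the [N]-th power of [exp ((t / N) X)], whose parameter
    is close to 0. *)
Lemma exp_subgroup X : (\forall t \near (0 : R), P (expG (t *: X))) ->
  forall t : R, P (expG (t *: X)).
Proof.
have [P1 PM _] := sP => /nbhs_ballP[r /= r0 rP] t.
pose N := (Num.truncn (`|t| / r)).+1.
have tN : P (expG ((t / N%:R) *: X)).
  apply: rP; rewrite -ball_normE /= sub0r normrN normrM normfV normr_nat.
  rewrite ltr_pdivrMr // mulrC -ltr_pdivrMr //; exact: truncnS_gt.
have -> : t *: X = N%:R *: ((t / N%:R) *: X).
  by rewrite scalerA mulrCA mulfV ?mulr1 // pnatr_eq0.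
rewrite expMn; move: (expG _) tN => y Py.
elim: N => [|j IH]; first by rewrite expg0.
by rewrite expgSr; exact: PM.
Qed.

Lemma coset_proj_exp h (X : 'rV[R]_n) (t : R) :
  pi (h * expG (t *: X))%g = pi h <-> P (expG (t *: X)).
Proof.
have [_ _ PV] := sP; split=> [/esym/(coset_projP sP)|Pt].
  by rewrite mulKg.
exact: coset_projM.
Qed.

Lemma tmap_coset_ker h X : (forall t : R, P (expG (t *: X))) ->
  tmap A B (fun a => pi (h * a)%g) 1%g X = 0.
Proof.
move=> PX.
have sF : smooth A B (fun a => pi (h * a)%g).
  exact: smooth_comp (smooth_lmul hG h) smooth_coset_proj.
have [d dE] := @exp_curve_image _ _ B (fun a => pi (h * a)%g) _ X sF (chart_at_mem _ _).
have := dE 1; rewrite scale1r -tmapE => <-.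
have -> : chart_at B (pi (h * 1)%g) \o (fun a => pi (h * a)%g) \o
    (fun t : R => expG (t *: X)) = fun=> chart_at B (pi (h * 1)%g) (pi h).
  by apply/funext => t /=; rewrite (coset_projM sP h (PX t)).
exact: differential_cst.
Qed.

(* The curve [t |-> h exp (t X) P] is an integral curve of the field whose flow
   is [left_translation P (h exp (t X) h^-1)]; if its velocity vanishes at [0],
   then it vanishes everywhere. *)
Lemma tmap_coset_ker_exp h X : tmap A B (fun a => pi (h * a)%g) 1%g X = 0 ->
  forall t : R, P (expG (t *: X)).
Proof.
(* Only small [t] remain, for which the curve stays in the chart domain of [pi h] and the mean value
   theorem applies. *)
move=> X0; apply: exp_subgroup.
pose F a := pi (h * a)%g.
have sF : smooth A B F by exact: smooth_comp (smooth_lmul hG h) smooth_coset_proj.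
pose q := pi h; pose g (t : R) := expG (t *: X).
pose u (t : R) := chart_at B q (F (g t)).
have du0 t : cdom (chart_at B q) (F (g t)) ->
    differentiable u t /\ forall s, differential u t s = 0.
  move=> qt; pose b := (h * g t * h^-1)%g.
  have sb : smooth A B (left_translation P b \o F).
    exact: smooth_comp sF (smooth_left_translation b).
  have bF1 : (left_translation P b \o F) 1%g = F (g t).
    by rewrite /= /F left_translationE // mulg1 /b -mulgA mulVg mulg1.
  have qb1 : cdom (chart_at B q) ((left_translation P b \o F) 1%g) by rewrite bF1.
  have [d dE] := exp_curve_image X sb qb1.
  have D0 : differential (mread A B 1%g q (left_translation P b \o F)) (c1 1%g) X = 0.
    have m1 := chart_at_mem A 1%g.
    rewrite (differential_mread_comp (q := F 1%g) X sF (smooth_left_translation b) m1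
      (chart_at_mem B _) qb1) -tmapE.
    by rewrite X0 linear0.
  have uE : u = (chart_at B q \o (left_translation P b \o F) \o (fun t : R => expG (t *: X)))
      \o (fun s : R => s - t).
    apply/funext => s; rewrite /u /= /F left_translationE // /b !mulgA.
    rewrite -[(_ * h^-1 * h)%g]mulgA mulVg mulg1 -[(h * g t * _)%g]mulgA -(expD hexp).
    by rewrite addrC subrK.
  have dt : is_diff t (fun s : R => s - t) id.
    by apply: is_diff_eq (is_diffB (is_diff_id t) (is_diff_cst t t)) _; rewrite subr0.
  have [dtd _] := dt; rewrite -(subrr t) in d dE.
  split; first by rewrite uE; exact: (@differentiable_comp R R R _ (fun s : R => s - t) _ t).
  move=> s; rewrite uE (@differential_comp R R R _ (fun s : R => s - t) _ t s) //.
  by rewrite dE D0 scaler0.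
have cF := smooth_continuous sF.
have cFg : continuous (F \o g).
  by move=> t; apply: continuous_comp; [exact: exp_curve_continuous|exact: cF].
have q0 : cdom (chart_at B q) ((F \o g) 0).
  by rewrite /= /F /g scale0r (exp0 hexp) mulg1; exact: chart_at_mem.
have nearq : \forall t \near (0 : R), cdom (chart_at B q) (F (g t)).
  by apply: cFg; apply: open_nbhs_nbhs; split=> //; exact: cdom_open.
have [r /= r0 rP] := (nbhs_ballP _ _).1 nearq.
apply/nbhs_ballP; exists r => //= t tr; apply/(coset_proj_exp h).
have g0 : F (g 0) = pi h by rewrite /F /g scale0r (exp0 hexp) mulg1.
rewrite -[RHS]g0 -[LHS](cmapK (rP _ tr)) -[RHS](cmapK q0); congr (cinv _ _).
rewrite -/(u t) -/(u 0).
apply/rowP => j; apply/eqP; rewrite -subr_eq0; apply/eqP.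
have seg (s : R) : 0 <= s <= 1 -> cdom (chart_at B q) (F (g (0 + s *: (t - 0)))).
  move=> /andP[s0 s1]; apply: rP; move: tr; rewrite -ball_normE /= !sub0r add0r subr0.
  rewrite !normrN /GRing.scale /= normrM (ger0_norm s0); apply: le_lt_trans.
  by rewrite ler_piMl.
have dj (s : R) : 0 <= s <= 1 -> differentiable (fun s => u s 0 j : R) (0 + s *: (t - 0)).
  move=> /seg/du0[d _].
  exact: (differentiable_comp d (differentiable_coord _ _ _)).
have [s s01 ->] := mean_value dj.
have [d dE] := du0 _ (seg s s01).
by rewrite -differential_rV // dE mxE.
Qed.

End HomogeneousSpace.

(** * Symmetries of the homogeneous model *)

Section Symmetries.
Context {R : realType} {G : groupWithTopologyType} {n m k : nat}.
Context {A : manifold R G n} {expG : 'rV[R]_n -> G} {gr : int -> {vspace 'rV[R]_n}}.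
Context {P : set G} {B : manifold R (coset_space P) m}.
Hypotheses (hG : lie_group A) (hexp : exponential_map A expG)
  (hss : semisimple A) (hgr : lie_grading (lie_bracket A) k gr)
  (hP : parabolic_subgroup A expG P k gr)
  (hker : discrete_subgroup (pair_kernel P))
  (hB : submersion A B (coset_proj P))
  (hconn : connected [set: coset_space P]).

Local Notation pi := (coset_proj P).
Local Notation F := (filtration k gr).
Local Notation br := (bracket A).
Local Notation c1 := (chart_at A 1%g).

Let sP : subgroup P. Proof. by case: hP. Qed.

Let Pexp X : (forall t : R, P (expG (t *: X))) <-> X \in F 0.
Proof. by case: hP => _ _ + _; exact. Qed.

Let AdF g i X : P g -> X \in F i -> AdL A g X \in F i.
Proof. by case: hP => _ _ _ AdF Pg Xi; rewrite AdL.unlock; exact: AdF. Qed.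

Let hbr : lie_grading br k gr. Proof. by rewrite bracket.unlock. Qed.

Let nondeg X : (forall Y, \tr (lin1_mx (br X) *m lin1_mx (br Y)) = 0) -> X = 0.
Proof. by rewrite bracket.unlock; exact: hss. Qed.

Let brPr := bracket_is_linear hG.

Let P_exp Z : Z \in F 0 -> P (expG Z).
Proof. by move=> /Pexp/(_ 1); rewrite scale1r. Qed.

Let F01 X : X \in F 1 -> X \in F 0.
Proof. exact: (filtration_le hbr (i := 0) (j := 1)). Qed.

(** All terms of [exp (ad Z) X] after the first contain a bracket with [Z], hence lie in [F 0]. *)
Lemma Ad_exp_filtration Z X : Z \in F 1 -> X \in F (-1) -> AdL A (expG Z) X - X \in F 0.
Proof.
move=> Z1 X1; have itF j : iter j (br Z) X \in F (-1 + j%:Z).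
  exact: (iter_br_filtration bracketPl brPr hbr).
(* Starting in [F (-1)], [k + 2] brackets with [Z] reach [F (k + 1)], which is zero. *)
rewrite (Ad_exp_nilpotent hG hexp (N := k.+1)); last first.
  by apply: (filtration_out hbr _ (itF k.+2)); rewrite !intS addKr ltrDr.
rewrite big_ord_recl /= fact0 invr1 scale1r addrAC subrr add0r.
apply: rpred_sum => j _; apply: memvZ; apply: (filtration_le hbr _ (itF j.+1)).
by rewrite intS addKr.
Qed.

(* If [E] is the grading element, then [Ad g^-1 E = Ad (exp Z) E] for some [Z] in
   [p_+]; then [g exp Z] fixes [E], hence preserves the eigenspaces of [ad E]. *)
Lemma levi_decomposition g : P g ->
  exists2 Z, Z \in F 1 & levi_subgroup A P gr (g * expG Z)%g.
Proof.
move=> Pg; have [P1 PM PV] := sP.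
have [E EP] := grading_element bracketPl brPr (bracket_Leibniz hG) nondeg hbr.
have W1 : AdL A g^-1%g E - E \in F 1.
  apply: (automorphism_grading_element bracketPl brPr (bracket_Leibniz hG) nondeg hbr EP
    (a := AdL A g^-1%g) (a' := AdL A g)).
  - exact: AdK.
  - by move=> X Y; rewrite bracket_Ad.
  - by move=> i X; apply: AdF; exact: PV.
  - by move=> i X; exact: AdF.
have [Z Z1 ZE] := exp_ad_grading_element bracketPl brPr (bracket_Leibniz hG) nondeg hbr EP W1.
rewrite addrC subrK in ZE.
have EF0 : E \in F 0.
  apply: (gr_filtration hbr (j := 0)) => //.
  exact: (grading_element_gr0 brPr (bracket_Leibniz hG) nondeg EP).
have gZE : AdL A (g * expG Z)%g E = E.
  rewrite (AdM hG) (Ad_exp_nilpotent hG hexp (N := k.+1)) ?ZE ?(AdVK hG) //.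
  have := iter_br_filtration bracketPl brPr hbr k.+2 Z1 EF0.
  by apply: (filtration_out hbr); rewrite add0r ltz_nat.
exists Z => //; split; first by apply: PM => //; apply: P_exp; exact: F01.
move=> i X Xi; rewrite -/(Ad A _ X).
have -> : Ad A (g * expG Z)%g X = AdL A (g * expG Z)%g X by rewrite AdL.unlock.
apply/EP; rewrite -[X in br X]gZE (bracket_Ad hG) (EP i X).1 //.
exact: linearZZ.
Qed.

Lemma symmetry_elements_sub : symmetry_elements A expG P k gr `<=` P.
Proof.
move=> _ [g0 [Z [[Pg0 _] _ Z1 ->]]]; have [_ PM _] := sP.
by apply: PM => //; apply: P_exp; exact: F01.
Qed.

Lemma symmetry_elementsP g : P g ->
  symmetry_elements A expG P k gr g <->
  forall Y, Y \in F (-1) -> AdL A g Y + Y \in F 0.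
Proof.
move=> Pg; have [P1 PM PV] := sP; split.
  move=> [g0 [Z [[Pg0 g0gr] g0N Z1 gE]]] Y Y1.
  pose Y' := hcomp hbr (-1) Y; pose Y0 := Y - Y'.
  have Y0F : Y0 \in F 0 := filtration_sub_hcomp hbr Y1.
  have Y'g : Y' \in gr (-1) := hcomp_mem hbr _ _.
  have Y'F : Y' \in F (-1) := gr_filtration hbr (lexx _) Y'g.
  (* As [Ad g0 Y' = - Y'], the sum [Ad g Y' + Y'] is [Ad g0] applied to [Ad (exp Z) Y' - Y']. *)
  have -> : AdL A g Y + Y = (AdL A g Y0 + Y0) + AdL A g0 (AdL A (expG Z) Y' - Y').
    have g0Y : AdL A g0 Y' = - Y' by rewrite AdL.unlock; exact: g0N.
    have -> : Y = Y0 + Y' by rewrite subrK.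
    rewrite [AdL A g0 (_ - _)](linearB (AdL A g0)) /= -(AdM hG) -gE g0Y opprK.
    rewrite [AdL A g (_ + _)](linearD (AdL A g)) /=.
    by rewrite addrACA.
  apply: memvD; first by apply: memvD => //; exact: AdF.
  by apply: AdF => //; exact: Ad_exp_filtration.
move=> gN; have [Z Z1 levi] := levi_decomposition Pg.
exists (g * expG Z)%g, (- Z); split=> //.
- move=> X X1; have X1F : X \in F (-1) := gr_filtration hbr (lexx _) X1.
  have AdE' : Ad A (g * expG Z)%g X = AdL A (g * expG Z)%g X by rewrite AdL.unlock.
  apply/eqP; rewrite -addr_eq0; apply/eqP.
  (* The sum has degree -1 because [g exp Z] preserves the grading, and it lies in [F 0] because
     modulo [F 0] this element acts like [g], that is as [- id]. *)
  apply: (gr_cap_filtration hbr (i := -1) (j := 0)) => //.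
    by apply: memvD => //; case: levi => _; exact.
  rewrite AdE' (AdM hG).
  have -> : AdL A g (AdL A (expG Z) X) + X =
      AdL A g (AdL A (expG Z) X - X) + (AdL A g X + X).
    by rewrite linearB /= addrA subrK.
  apply: memvD; last exact: gN.
  by apply: AdF => //; exact: Ad_exp_filtration.
- by rewrite memvN.
- by rewrite (expN hexp) mulgK.
Qed.

(** * Automorphisms and tangent maps of the homogeneous model *)

Let C := homogeneous_model A B.

Lemma maurer_cartanE a v : maurer_cartan A a v = tmap A A (fun b => (a^-1 * b)%g) a v.
Proof. by rewrite tmap.unlock. Qed.

(** The inner map is the Maurer-Cartan form at [u]; its left inverse is the differential at 1 of
    translation by [u]. *)
Lemma tmap_lmulV u v :
  tmap A A (fun b => (u * b)%g) 1%g (tmap A A (fun b => (u^-1 * b)%g) u v) = v.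
Proof.
have := tmap_comp u v (smooth_lmul hG u^-1%g) (smooth_lmul hG u).
rewrite mulVg => <-; rewrite (_ : _ \o _ = id) ?tmap_id //.
by apply/funext => b /=; rewrite mulgA mulgV mul1g.
Qed.

Lemma tmap_lmul_inj u : injective (tmap A A (fun b => (u^-1 * b)%g) u).
Proof. exact: can_inj (tmap_lmulV u). Qed.

(** Left invariance of the Maurer-Cartan form, written with tangent maps of translations. *)
Lemma maurer_cartan_lmul g u v :
  tmap A A (fun b => ((g * u)^-1 * b)%g) (g * u)%g (tmap A A (fun b => (g * b)%g) u v) =
  tmap A A (fun b => (u^-1 * b)%g) u v.
Proof.
rewrite -(tmap_comp u v (smooth_lmul hG g) (smooth_lmul hG (g * u)^-1%g)).
congr (tmap A A _ u v); apply/funext => b /=.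
by rewrite invgM -mulgA mulKg.
Qed.

Lemma diffeomorphism_lmul g : diffeomorphism A A (fun a => (g * a)%g).
Proof.
split; first exact: smooth_lmul.
exists (fun a => (g^-1 * a)%g); split; first exact: smooth_lmul.
- by move=> a; rewrite mulKg.
- by move=> a; rewrite mulVKg.
Qed.

Lemma cartan_automorphism_lmul g : cartan_automorphism (C := C) (fun a => (g * a)%g).
Proof.
split; first exact: diffeomorphism_lmul.
  by move=> u h _ /=; rewrite mulgA.
move=> u v /=; rewrite !maurer_cartanE -[RHS](maurer_cartan_lmul g).
have -> : tangent_map A A (fun a => (g * a)%g) u v = tmap A A (fun a => (g * a)%g) u v.
  by rewrite tmap.unlock.
by [].
Qed.

Lemma coset_open (U : set (coset_space P)) : open (pi @^-1` U) -> open U.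
Proof. by []. Qed.

(* [f a = phi a * a^-1] has derivative zero, since at [u] it agrees to first
   order with [a |-> (phi u * u^-1 * a) * a^-1]. *)
Lemma cartan_automorphism_is_lmul (phi : G -> G) :
  cartan_automorphism (C := C) phi -> exists g, forall a, phi a = (g * a)%g.
Proof.
move=> [[sphi _] phiP phimc]; rewrite /= in sphi phiP phimc.
pose f a := (phi a * a^-1)%g.
have sinv : smooth A A (fun a : G => a^-1%g) := smooth_inv hG (smooth_id A).
have sf : smooth A A f := smooth_mul hG sphi sinv.
have f0 u v : tmap A A f u v = 0.
  pose g := (phi u * u^-1)%g; have gu : (g * u)%g = phi u by rewrite /g -mulgA mulVg mulg1.
  have tphi : tmap A A phi u v = tmap A A (fun a => (g * a)%g) u v.
    (* The Maurer-Cartan form at [phi u] takes the same value on both vectors: for [phi] because it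
       is an automorphism, for the translation by left invariance. *)
    apply: (@tmap_lmul_inj (phi u)).
    rewrite -[in RHS]gu maurer_cartan_lmul -!maurer_cartanE -[RHS]phimc.
    have -> : tangent_map A A phi u v = tmap A A phi u v by rewrite tmap.unlock.
    by [].
  (* The product rule is used in both directions, so as to replace [phi] by the translation by [g];
     then the product with the inverse is constant. *)
  rewrite (tmap_mul hG _ _ sphi sinv) tphi -gu.
  rewrite -(tmap_mul hG _ _ (smooth_lmul hG g) sinv).
  rewrite (_ : (fun a => _) = fun=> g) ?tmap_cst //.
  by apply/funext => a; rewrite -mulgA mulgV mulg1.
(* [G] may be disconnected, so local constancy does not yet make [f] constant. Being invariant under
   [P], it descends to [G/P], where its fibres are open and closed. *)
have fP a p : P p -> f (a * p)%g = f a.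
  by move=> Pp; rewrite /f phiP // invgM mulgA -[(_ * p * _)%g]mulgA mulgV mulg1.
pose fQ (x : coset_space P) := f (repr (x : {eq_quot (lcoset_equiv P)}%qT)).
have fQE a : fQ (pi a) = f a.
  rewrite /fQ; set b := repr _.
  have /esym/(coset_projP sP) Pab : pi b = pi a by exact: coset_reprK.
  by rewrite -[b](mulVKg a) fP.
have fcst := tmap0_locally_constant sf f0.
have oD (D : set G) : open (f @^-1` D).
  rewrite openE => a Da; rewrite /interior; apply: filterS (fcst a) => b fb.
  by rewrite /preimage /= fb.
pose X0 := fQ @^-1` [set f 1%g].
have preE (D : set G) : pi @^-1` (fQ @^-1` D) = f @^-1` D.
  by apply/seteqP; split=> a; rewrite /preimage /= fQE.
have X0T : X0 = [set: coset_space P].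
  apply: hconn.
  - by exists (pi 1%g); rewrite /X0 /preimage /= fQE.
  - by exists X0; rewrite ?setTI //; apply: coset_open; rewrite preE.
  - exists X0; rewrite ?setTI // -openC; apply: coset_open.
    have -> : ~` X0 = fQ @^-1` ~` [set f 1%g] by [].
    by rewrite preE.
exists (f 1%g) => a.
have : X0 (pi a) by rewrite X0T.
by rewrite /X0 /preimage /= fQE => <-; rewrite /f -mulgA mulVg mulg1.
Qed.

(** The point [h] of the fibre over [h P] identifies [g/p] with the tangent space there; [T h] is
    this identification before passing to the quotient. *)
Let T h Y := tmap A B (fun a => pi (h * a)%g) 1%g Y.

Let smooth_T h : smooth A B (fun a => pi (h * a)%g).
Proof. exact: smooth_comp (smooth_lmul hG h) (smooth_coset_proj hB). Qed.

Let T0 h Y : T h Y = 0 <-> Y \in F 0.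
Proof.
split=> [/(tmap_coset_ker_exp hG hexp sP hB)/Pexp //|/Pexp].
exact: (tmap_coset_ker hG hexp sP hB).
Qed.

(** Equivariance of the identification: [h g a P] equals [h (g a g^-1) P] for [g] in [P]. *)
Let T_conj h g Y : P g -> tmap A B (fun a => pi (h * g * a)%g) 1%g Y = T h (AdL A g Y).
Proof.
have [_ _ PV] := sP => Pg; rewrite /T AdE.
have := tmap_comp 1%g Y (smooth_conj hG g) (smooth_T h); rewrite mulg1 mulgV => <-.
congr (tmap _ _ _ _ _); apply/funext => a /=.
by rewrite !mulgA [RHS](coset_projM sP _ (PV _ Pg)).
Qed.

(** [Tminus1] ranges over all points [u] of the fibre. Such a [u] differs from [h] by an element of
    [P], and [Ad] of this element preserves [F (-1)], so the single point [h] suffices. *)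
Lemma Tminus1P h (w : 'rV[R]_m) :
  Tminus1 (C := C) k gr (pi h) w <-> exists2 Y, Y \in F (-1) & w = T h Y.
Proof.
have [_ PM PV] := sP; have spi := smooth_coset_proj hB.
have TE u Y : tmap A B pi u (tmap A A (fun b => (u * b)%g) 1%g Y) =
    tmap A B (fun a => pi (u * a)%g) 1%g Y.
  by have := tmap_comp 1%g Y (smooth_lmul hG u) spi; rewrite mulg1 => <-.
split=> [[u [v [/= uh vF wE]]]|[Y YF ->]].
  rewrite maurer_cartanE in vF; set X := tmap _ _ _ u v in vF.
  have /(coset_projP sP) Pp : pi h = pi u by [].
  exists (AdL A (h^-1 * u)%g X); first exact: AdF.
  rewrite -T_conj // mulVKg -TE tmap_lmulV wE.
  by rewrite tmap.unlock.
exists h, (tmap A A (fun b => (h * b)%g) 1%g Y); split=> //=.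
  rewrite maurer_cartanE.
  have := maurer_cartan_lmul h 1%g Y; rewrite mulg1 => ->.
  by rewrite (_ : (fun b => _) = id) ?tmap_id //; apply/funext => b; rewrite invg1 mul1g.
by rewrite -[T h Y]TE tmap.unlock.
Qed.

Lemma tmap_left_translation h g Y : P g ->
  tmap B B (left_translation P (h * g * h^-1)%g) (pi h) (T h Y) = T h (AdL A g Y).
Proof.
move=> Pg; rewrite -T_conj //.
have := tmap_comp 1%g Y (smooth_T h) (smooth_left_translation hG sP hB (h * g * h^-1)%g).
rewrite mulg1 => <-; congr (tmap _ _ _ _ _); apply/funext => a /=.
by rewrite left_translationE // mulgA -[(_ * h^-1 * h)%g]mulgA mulVg mulg1.
Qed.

Lemma diffeomorphism_left_translation g : diffeomorphism B B (left_translation P g).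
Proof.
have sl := smooth_left_translation hG sP hB.
have E a b x : left_translation P a (left_translation P b x) = left_translation P (a * b)%g x.
  by rewrite -(left_translation_comp sP).
split=> //; exists (left_translation P g^-1%g); split=> // x; rewrite E.
  by rewrite mulVg (left_translation1 sP).
by rewrite mulgV (left_translation1 sP).
Qed.

Lemma symmetryP h (s : coset_space P -> coset_space P) :
  symmetry C k gr (pi h) s <->
  exists2 g, symmetry_elements A expG P k gr g & s = left_translation P (h * g * h^-1)%g.
Proof.
have tB (f : coset_space P -> coset_space P) x v : tangent_map B B f x v = tmap B B f x v.
  by rewrite tmap.unlock.
split=> [[_ sx sN [phi [/cartan_automorphism_is_lmul[b phib] phis]]]|[g Sg ->]].
  have sE : s = left_translation P b.
    apply/funext => x; rewrite -[x]coset_reprK left_translationE //.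
    by have := phis (repr (x : {eq_quot (lcoset_equiv P)}%qT)); rewrite phib => <-.
  (* Fixing [h P] says exactly that this conjugate of [b] lies in [P]. *)
  pose g := (h^-1 * (b * h))%g.
  have Pg : P g.
    by apply/(coset_projP sP); rewrite -[LHS]sx sE left_translationE.
  have bE : b = (h * g * h^-1)%g by rewrite /g mulVKg -mulgA mulgV mulg1.
  exists g; last by rewrite -bE.
  apply/(symmetry_elementsP Pg) => Y YF; apply/(T0 h); rewrite /T linearD /=.
  have := sN (T h Y) ((Tminus1P h _).2 (ex_intro2 _ _ Y YF erefl)).
  by rewrite /= tB sE bE tmap_left_translation // /T => ->; rewrite addNr.
have Pg := symmetry_elements_sub Sg.
split.
- exact: diffeomorphism_left_translation.
- by rewrite left_translationE // -mulgA mulVg mulg1 (coset_projM sP).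
- move=> w /Tminus1P[Y YF ->]; rewrite /= tB tmap_left_translation //.
  apply/eqP; rewrite -addr_eq0 -linearD; apply/eqP/(T0 h).
  exact: (symmetry_elementsP Pg).1 Sg Y YF.
- exists (fun a => (h * g * h^-1 * a)%g); split; first exact: cartan_automorphism_lmul.
  by move=> a /=; rewrite left_translationE.
Qed.

(** The elements acting trivially on [G/P] form a normal subgroup, and they lie in [P] because they
    fix the origin. *)
Lemma left_translation_kernel a b :
  left_translation P a = left_translation P b -> pair_kernel P (a^-1 * b)%g.
Proof.
move=> ab; exists [set c | left_translation P c = id]; split.
- split; first split.
  + exact: left_translation1.
  + by move=> c d /= cE dE; rewrite -(left_translation_comp sP) cE dE.
  + move=> c /= cE; have := left_translation_comp sP c^-1%g c.
    by rewrite mulVg (left_translation1 sP) cE.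
  + move=> c d /= dE; rewrite -!(left_translation_comp sP) dE /=.
    by rewrite (left_translation_comp sP) mulgV (left_translation1 sP).
- move=> c /= cE; have := left_translationE sP c 1%g.
  by rewrite cE mulg1 => /(coset_projP sP); rewrite invg1 mul1g.
- rewrite /= -(left_translation_comp sP) -ab (left_translation_comp sP).
  by rewrite mulVg (left_translation1 sP).
Qed.

(** By discreteness an element [exp (t Z)] of the kernel with small [t] is 1. Since the curve has
    velocity [Z] at 0, its first-order error at such a [t] is [|t| |Z|], which exceeds the allowed
    half of it unless [t = 0]. *)
Lemma exp_kernel_small (Z : 'rV[R]_n) : Z != 0 ->
  \forall t \near (0 : R), pair_kernel P (expG (t *: Z)) -> t = 0.
Proof.
move=> Z0; have Zgt0 : 0 < `|Z| by rewrite normr_gt0.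
have e0 : 0 < `|Z| / 2 by rewrite divr_gt0.
have K1 : pair_kernel P 1%g.
  exists [set 1%g]; split=> //.
    split; first by split=> // [a b -> ->|a ->]; rewrite ?mulg1 ?invg1.
    by move=> a b ->; rewrite mulg1 mulgV.
  by move=> _ ->; case: sP.
have near1 : \forall t \near (0 : R), pair_kernel P (expG (t *: Z)) -> expG (t *: Z) = 1%g.
  have H : \forall b \near expG (0 *: Z), pair_kernel P b -> b = 1%g.
    by rewrite scale0r (exp0 hexp); exact: hker K1.
  exact: (exp_curve_continuous hexp (X := Z) (x := 0) H).
have nearZ := differential_eps (exp_curve_differentiable hexp Z) e0.
apply: filterS2 near1 nearZ => t t1 tZ /t1 E; move: tZ.
rewrite (exp_curve_differential hexp) /= E scale0r (exp0 hexp) subrr subr0 sub0r.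
rewrite normrN normrZ mulrC => H; apply/eqP; rewrite -normr_le0.
have : `|t| * (`|Z| / 2) <= 0 by have := H; lra.
by rewrite pmulr_lle0.
Qed.

Lemma symmetries_infinite (x : coset_space P) :
  (exists s, symmetry C k gr x s) -> infinite_set [set s | symmetry C k gr x s].
Proof.
rewrite -[x]coset_reprK; set h := repr _ => -[s /symmetryP[g [g0 [Z0 [levi g0N Z01 _]]] _]].
have [[k0 grk _] _ _ _ _] := hgr.
(* The top component of a grading is nonzero, and it lies in [F 1] because [k] is positive. *)
pose Z := vpick (gr k%:Z).
have Z1 (t : R) : t *: Z \in F 1.
  by apply: memvZ; apply: (gr_filtration hbr (j := k%:Z)); [rewrite lez_nat|exact: memv_pick].
have Zn0 : Z != 0 by rewrite vpick0.
have [r /= r0 rP] := (nbhs_ballP _ _).1 (exp_kernel_small Zn0).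
(* Distinct parameters strictly between 0 and [r], so that their differences stay within the radius
   given by [exp_kernel_small]. *)
pose t (j : nat) : R := r / j.+2%:R.
have tpos j : 0 < t j by rewrite divr_gt0.
have tr j : t j < r by rewrite ltr_pdivrMr // ltr_pMr // ltr1n.
pose f j := left_translation P (h * (g0 * expG (t j *: Z)) * h^-1)%g.
have fS j : symmetry C k gr (pi h) (f j).
  apply/symmetryP; exists (g0 * expG (t j *: Z))%g => //.
  by exists g0, (t j *: Z).
have finj : injective f.
  move=> i j /left_translation_kernel [K [[sK nK] KP]].
  set c := (_^-1 * _)%g => Kc.
  (* Conjugating by [h^-1] removes [h] from [c], and normality of [K] keeps the result in the
     kernel. *)
  have cE : expG ((t j - t i) *: Z) = (h^-1 * c * h^-1^-1)%g.
    rewrite /c [in LHS]addrC (expD hexp) scaleNr (expN hexp) !invgM !invgK !mulgA mulVg mul1g.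
    by rewrite !mulgVK.
  have : t j - t i = 0.
    apply: rP.
      rewrite -ball_normE /= sub0r normrN ltr_norml.
      have := tpos i; have := tpos j; have := tr i; have := tr j; move: (t i) (t j).
      by move=> *; apply/andP; split; lra.
    by exists K; split=> //; rewrite cE; exact: nK.
  move/eqP; rewrite subr_eq0 => /eqP/(mulfI (lt0r_neq0 r0))/invr_inj/eqP.
  by rewrite eqr_nat => /eqP[->].
move=> fin; apply: infinite_nat.
have := finite_preimage (f := f) (fun i j _ _ => @finj i j) fin.
rewrite (_ : _ @^-1` _ = setT) //.
by apply/seteqP; split=> // j _; exact: fS.
Qed.

End Symmetries.

Theorem proposition2p4 (R : realType) (G : groupWithTopologyType) (n m k : nat)
    (A : manifold R G n) (expG : 'rV[R]_n -> G)
    (gr : int -> {vspace 'rV[R]_n}) (P : set G)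
    (B : manifold R (coset_space P) m)
    (hG : lie_group A) (hexp : exponential_map A expG)
    (hss : semisimple A) (hgr : lie_grading (lie_bracket A) k gr)
    (hP : parabolic_subgroup A expG P k gr)
    (hker : discrete_subgroup (pair_kernel P))
    (hB : submersion A B (coset_proj P))
    (hconn : connected [set: coset_space P]) :
  let C := homogeneous_model A B in
  let S := symmetry_elements A expG P k gr in
  [/\ S `<=` P,
      forall s : coset_space P -> coset_space P,
        symmetry C k gr (coset_proj P 1%g) s <->
        exists2 g, S g & s = left_translation P g,
      forall (h : G) (s : coset_space P -> coset_space P),
        symmetry C k gr (coset_proj P h) s <->
        exists2 g, S g & s = left_translation P (h * g * h^-1)%g &
      forall x : coset_space P,
        (exists s, symmetry C k gr x s) ->
        infinite_set [set s | symmetry C k gr x s]].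
Proof.
move=> C S; have symP := symmetryP hG hexp hss hgr hP hB hconn; split=> //.
- exact: symmetry_elements_sub.
- move=> s; apply: iff_trans (symP 1%g s) _.
  by split=> -[g Sg ->]; exists g; rewrite ?invg1 ?mul1g ?mulg1.
- exact: symmetries_infinite.
Qed.
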